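(* Let $N \geqslant 2$ be an integer and let $f(z) = \sum_{n=0}^\infty a_n z^n$ be an $N$-good Taylor series with complex coefficients and radius of convergence equal to $1$. Then $f$ cannot be extended analytically through the arc $\mathcal{C} = \{ e^{i\theta} \mid \theta \in [-\frac{4\pi}{N},\frac{4\pi}{N}] \}$, i.e. $f$ is not analytic on $\{ |z| < 1 \} \cup \mathcal{C}$.
   Context: For an integer $N \geqslant 2$, a formal Taylor series $f(z) = \sum_{n=0}^{\infty} a_n z^n$ with complex coefficients is called $N$-good if one can write $a_n = r_n e^{i \phi_n}$ with $r_n \geqslant 0$, $\phi_n \in \mathbb{R}$ for all $n \geqslant 0$, such that for each $n \geqslant 0$ there exists some $\Phi_n \in \mathbb{R}$ with $\phi_n, \phi_{n+1}, \ldots, \phi_{n+N-1} \in [\Phi_n, \Phi_n + \frac{\pi}{2}]$. Saying that $f$ is analytic on $\{|z|<1\} \cup \mathcal{C}$ means that there exist an open set $U \supseteq \{|z|<1\} \cup \mathcal{C}$ and a holomorphic function on $U$ that coincides with $f$ on $\{|z|<1\}$. *)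

(* Defs.v *)
From Stdlib Require Import Reals.
From Coquelicot Require Import Coquelicot.

Local Open Scope R_scope.

(** [expi t] is e^{it}. *)
Definition expi (t : R) : C := (cos t, sin t).

Definition N_good (N : nat) (a : nat -> C) : Prop :=
  exists (r phi : nat -> R),
    (forall n, 0 <= r n) /\
    (forall n, a n = Cmult (RtoC (r n)) (expi (phi n))) /\
    (forall n, exists Phi : R,
       forall k, (k < N)%nat -> Phi <= phi (n + k)%nat <= Phi + PI / 2).

(** Coquelicot's [CV_radius] is stated for real coefficients; it is the
    supremum of the [r] such that [sum |a_n r^n|] converges, so applied to the
    moduli it is the radius of convergence of the complex series. *)
Definition C_CV_radius (a : nat -> C) : Rbar := CV_radius (fun n => Cmod (a n)).

(** Complex differentiability at every point of [U]: the scalars are the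
    complex numbers, not the reals. *)
Definition holomorphic_on (U : C -> Prop) (g : C -> C) : Prop :=
  forall z : C, U z -> @ex_derive C_AbsRing C_NormedModule g z.

(** The closed arc of the unit circle between e^{-i alpha} and e^{i alpha}
    (the whole circle as soon as [PI <= alpha]). *)
Definition unit_arc (alpha : R) (z : C) : Prop :=
  exists theta : R, - alpha <= theta <= alpha /\ z = expi theta.

(** The sum of [a_n z^n] is analytic on the union of the open unit disc and
    [A].  The relation [is_pseries a z (g z)] says that the series converges
    at [z] and that its sum is [g z]. *)
Definition analytic_on_disc_union (a : nat -> C) (A : C -> Prop) : Prop :=
  exists (U : C -> Prop) (g : C -> C),
    @open C_UniformSpace U /\
    (forall z : C, Cmod z < 1 \/ A z -> U z) /\
    holomorphic_on U g /\
    (forall z : C, Cmod z < 1 ->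
       @is_pseries C_AbsRing C_NormedModule a z (g z)).

(* Main.v *)
Require Import Defs.
From Stdlib Require Import Reals Lra Lia Classical ClassicalEpsilon.
From Coquelicot Require Import Coquelicot.

(** Suppose that [g] extends the series beyond the arc.  Two facts contradict
    each other.

    Positivity.  Let [T] be a real trigonometric polynomial of degree less than
    [N] whose coefficients are nonnegative, with a positive constant
    coefficient [T_0], and which is nonpositive off the arc.  If the phases of
    any [N] consecutive coefficients [c_j] lie in a quarter turn, then
    [Re (c_i * conj c_j) >= 0] for [|i - j| < N].  Hence, for
    [P = sum c_j z^j], the mean of [|P|^2 T] over the circle is at least
    [T_0 sum |c_j|^2], and it is at most a constant times the supremum of
    [|P|^2] on the arc.  So the size of a good polynomial on the arc controls
    each of its coefficients ([coefficient_bound_by_arc]).  Such a [T] exists for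
    the arc of half-angle [2 PI / N]: it is
    [|sum_j sin (j PI / N) e^{ijt}|^2 (cos t - cos (2 PI / N))], and the signs of
    its coefficients come from a Christoffel-Darboux identity
    ([christoffel_darboux]).  As the half-angle [4 PI / N] is larger, this arc is
    contained in the given one.

    Cauchy estimates.  The functions [z^k f^(k)(z) / k! = sum binom(j, k) a_j z^j]
    have coefficients with the same phases.  As [g] is holomorphic and bounded on
    discs of a fixed radius around all points of the sector spanned by the arc
    ([sector_uniform_bound]), these functions are of order [R^(-k)] there,
    uniformly in [|z| < 1] ([cauchy_estimate]).  The contour integrals are taken
    in the coordinate [log w], and their independence of the radius follows from
    Goursat's bisection argument ([flux_zero]).

    Together, [binom(j, k) |a_j| rho^j <= K R^(-k)] for all [j] and [k], with [K]
    independent of [rho < 1].  Multiplying by [(R / 2)^k] and summing over [k]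
    shows that [|a_j| (rho (1 + R / 2))^j] is bounded; for [rho] near 1 this
    contradicts the radius of convergence 1. *)

Local Open Scope R_scope.

(** * Finite real sums *)

Lemma sum_mult_sum (f g : nat -> R) (m n : nat) :
  sum_f_R0 f m * sum_f_R0 g n =
  sum_f_R0 (fun i => sum_f_R0 (fun j => f i * g j) n) m.
Proof.
  rewrite Rmult_comm, scal_sum. apply sum_eq; intros i _.
  rewrite scal_sum. apply sum_eq; intros j _. ring.
Qed.

Lemma sum_swap (f : nat -> nat -> R) (m n : nat) :
  sum_f_R0 (fun i => sum_f_R0 (f i) n) m =
  sum_f_R0 (fun j => sum_f_R0 (fun i => f i j) m) n.
Proof.
  induction m as [|m IH]; simpl; [reflexivity|].
  rewrite IH, <- plus_sum. reflexivity.
Qed.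

Lemma sum_nonneg (f : nat -> R) (n : nat) :
  (forall j, (j <= n)%nat -> 0 <= f j) -> 0 <= sum_f_R0 f n.
Proof.
  intros hf. induction n as [|n IH]; simpl; [apply hf; lia|].
  apply Rplus_le_le_0_compat; [apply IH; intros; apply hf|apply hf]; lia.
Qed.

Lemma sum_ge_term (f : nat -> R) (n i : nat) :
  (i <= n)%nat -> (forall j, (j <= n)%nat -> 0 <= f j) -> f i <= sum_f_R0 f n.
Proof.
  intros hi hf. induction n as [|n IH]; simpl.
  - replace i with 0%nat by lia. lra.
  - assert (h : 0 <= f (S n)) by (apply hf; lia).
    destruct (Nat.eq_dec i (S n)) as [->|ne].
    + assert (0 <= sum_f_R0 f n) by (apply sum_nonneg; intros; apply hf; lia). lra.
    + assert (f i <= sum_f_R0 f n) by (apply IH; [lia|intros; apply hf; lia]). lra.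
Qed.

(** * Means over roots of unity *)

(** The points [root_angle m s], for [s <= m], are the arguments of the
    [S m]-th roots of unity.  Averaging over them integrates exactly every
    trigonometric polynomial of degree at most [m], so finite sums can play the
    part of integrals over the circle. *)
Definition root_angle (m s : nat) : R := 2 * PI * INR s / INR (S m).

(** Telescoping: [2 sin h cos y = sin (y + h) - sin (y - h)]. *)
Lemma sum_cos_progression (x h : R) (m : nat) :
  2 * sin h * sum_f_R0 (fun s => cos (x + 2 * h * INR s)) m =
  sin (x + h * (2 * INR m + 1)) - sin (x - h).
Proof.
  assert (H : forall y, 2 * sin h * cos y = sin (y + h) - sin (y - h)).
  { intro y. rewrite sin_plus, sin_minus. ring. }
  induction m as [|m IH].
  - simpl. rewrite H. f_equal; f_equal; ring.
  - rewrite tech5, Rmult_plus_distr_l, IH, H, S_INR.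
    replace (x + 2 * h * (INR m + 1) + h) with (x + h * (2 * (INR m + 1) + 1)) by ring.
    replace (x + 2 * h * (INR m + 1) - h) with (x + h * (2 * INR m + 1)) by ring.
    ring.
Qed.

Lemma sum_cos_roots_pos (x : R) (m d : nat) :
  (0 < d <= m)%nat ->
  sum_f_R0 (fun s => cos (x + INR d * root_angle m s)) m = 0.
Proof.
  intros hd. set (h := INR d * PI / INR (S m)).
  assert (hm : 0 < INR (S m)) by (apply lt_0_INR; lia).
  assert (hpi := PI_RGT_0).
  assert (hdm : 0 < INR d < INR (S m)) by (split; [apply lt_0_INR|apply lt_INR]; lia).
  assert (hh : 0 < h < PI).
  { unfold h. split.
    - apply Rdiv_lt_0_compat; nra.
    - apply Rlt_div_l; nra. }
  assert (hs : 0 < sin h) by (apply sin_gt_0; lra).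
  rewrite (sum_eq _ (fun s => cos (x + 2 * h * INR s))).
  2:{ intros s _. f_equal. unfold root_angle, h. field. lra. }
  apply Rmult_eq_reg_l with (2 * sin h); [|lra].
  rewrite sum_cos_progression, Rmult_0_r.
  replace (x + h * (2 * INR m + 1)) with ((x - h) + 2 * INR d * PI).
  - rewrite sin_period. ring.
  - unfold h. rewrite S_INR in *. field. lra.
Qed.

Lemma sum_cos_roots (x : R) (m p q : nat) :
  (p <= m + q)%nat -> (q <= m + p)%nat ->
  sum_f_R0 (fun s => cos (x + (INR p - INR q) * root_angle m s)) m =
  if Nat.eq_dec p q then INR (S m) * cos x else 0.
Proof.
  intros h1 h2. destruct (Nat.eq_dec p q) as [->|ne].
  - rewrite (sum_eq _ (fun _ => cos x)).
    + rewrite sum_cte. ring.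
    + intros s _. f_equal. ring.
  - destruct (Nat.lt_total p q) as [lt|[e|gt]]; [|contradiction|].
    + rewrite (sum_eq _ (fun s => cos (- x + INR (q - p) * root_angle m s))).
      * apply sum_cos_roots_pos; lia.
      * intros s _. rewrite <- cos_neg, minus_INR by lia. f_equal. ring.
    + rewrite (sum_eq _ (fun s => cos (x + INR (p - q) * root_angle m s))).
      * apply sum_cos_roots_pos; lia.
      * intros s _. rewrite minus_INR by lia. f_equal.
Qed.

(** [|sum_j r_j e^{i phi_j} e^{ijt}|^2]. *)
Definition sqmod (r phi : nat -> R) (n : nat) (t : R) : R :=
  (sum_f_R0 (fun j => r j * cos (phi j + INR j * t)) n) ^ 2 +
  (sum_f_R0 (fun j => r j * sin (phi j + INR j * t)) n) ^ 2.

Lemma sqmod_nonneg (r phi : nat -> R) (n : nat) (t : R) : 0 <= sqmod r phi n t.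
Proof. unfold sqmod. assert (H := pow2_ge_0). apply Rplus_le_le_0_compat; apply H. Qed.

Lemma sqmod_double_sum (r phi : nat -> R) (n : nat) (t : R) :
  sqmod r phi n t =
  sum_f_R0 (fun i => sum_f_R0 (fun j =>
    r i * r j * cos (phi i - phi j + (INR i - INR j) * t)) n) n.
Proof.
  unfold sqmod. rewrite <- !Rsqr_pow2. unfold Rsqr.
  rewrite !sum_mult_sum, <- plus_sum.
  apply sum_eq; intros i _. rewrite <- plus_sum.
  apply sum_eq; intros j _.
  replace (phi i - phi j + (INR i - INR j) * t)
    with ((phi i + INR i * t) - (phi j + INR j * t)) by ring.
  rewrite cos_minus. ring.
Qed.

(** The form in which a good sequence of phases is used: the coefficients with
    indices [i] and [j] at distance less than [N] satisfy
    [Re (a_i * conj a_j) >= 0]. *)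
Definition quarter_close (N : nat) (phi : nat -> R) : Prop :=
  forall i j, (i < N + j)%nat -> (j < N + i)%nat -> 0 <= cos (phi i - phi j).

(** [S m] times the mean of [|P|^2 F] over the [S m]-th roots of unity, where
    [P] is the polynomial with coefficients [r_j e^{i phi_j}]; when [F] is a
    trigonometric polynomial and [m] is large, this mean is the one over the
    circle. *)
Definition moment (r phi : nat -> R) (n m : nat) (F : R -> R) : R :=
  sum_f_R0 (fun s => sqmod r phi n (root_angle m s) * F (root_angle m s)) m.

Lemma moment_plus r phi n m F G :
  moment r phi n m (fun t => F t + G t) = moment r phi n m F + moment r phi n m G.
Proof.
  unfold moment. rewrite <- plus_sum. apply sum_eq; intros; ring.
Qed.

Lemma moment_scal r phi n m c F :
  moment r phi n m (fun t => c * F t) = c * moment r phi n m F.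
Proof.
  unfold moment. rewrite scal_sum. apply sum_eq; intros; ring.
Qed.

Lemma moment_sum r phi n m (F : nat -> R -> R) k :
  moment r phi n m (fun t => sum_f_R0 (fun j => F j t) k) =
  sum_f_R0 (fun j => moment r phi n m (F j)) k.
Proof.
  induction k as [|k IH]; simpl; [reflexivity|].
  rewrite moment_plus, IH. reflexivity.
Qed.

Lemma moment_ext r phi n m F G :
  (forall t, F t = G t) -> moment r phi n m F = moment r phi n m G.
Proof. intros H. unfold moment. apply sum_eq; intros; rewrite H; ring. Qed.

(** The product of cosines splits into the frequencies [(i - j) + (p - q)] and
    [(i - j) - (p - q)]; only the frequency zero survives the summation. *)
Lemma cross_term_sum (x : R) (m i j p q : nat) :
  (i + p <= m)%nat -> (i + q <= m)%nat -> (j + p <= m)%nat -> (j + q <= m)%nat ->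
  sum_f_R0 (fun s => cos (x + (INR i - INR j) * root_angle m s) *
                     cos ((INR p - INR q) * root_angle m s)) m =
  ((if Nat.eq_dec (i + p) (j + q) then INR (S m) * cos x else 0) +
   (if Nat.eq_dec (i + q) (j + p) then INR (S m) * cos x else 0)) / 2.
Proof.
  intros h1 h2 h3 h4.
  rewrite <- (sum_cos_roots x m (i + p) (j + q)) by lia.
  rewrite <- (sum_cos_roots x m (i + q) (j + p)) by lia.
  rewrite <- plus_sum. unfold Rdiv. rewrite Rmult_comm, scal_sum.
  apply sum_eq; intros s _. rewrite !plus_INR.
  set (t := root_angle m s).
  replace (x + (INR i + INR p - (INR j + INR q)) * t)
    with ((x + (INR i - INR j) * t) + (INR p - INR q) * t) by ring.
  replace (x + (INR i + INR q - (INR j + INR p)) * t)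
    with ((x + (INR i - INR j) * t) - (INR p - INR q) * t) by ring.
  rewrite (cos_plus (x + _)), (cos_minus (x + _)). field.
Qed.

Lemma moment_cos r phi n m p q :
  moment r phi n m (fun t => cos ((INR p - INR q) * t)) =
  sum_f_R0 (fun i => sum_f_R0 (fun j => r i * r j *
    sum_f_R0 (fun s => cos (phi i - phi j + (INR i - INR j) * root_angle m s) *
                     cos ((INR p - INR q) * root_angle m s)) m) n) n.
Proof.
  unfold moment.
  rewrite (sum_eq _ (fun s => sum_f_R0 (fun i => sum_f_R0 (fun j =>
    r i * r j * (cos (phi i - phi j + (INR i - INR j) * root_angle m s) *
     cos ((INR p - INR q) * root_angle m s))) n) n)).
  2:{ intros s _. rewrite sqmod_double_sum, Rmult_comm, scal_sum.
      apply sum_eq; intros i _. rewrite Rmult_comm, scal_sum.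
      apply sum_eq; intros j _. ring. }
  rewrite sum_swap. apply sum_eq; intros i _.
  rewrite sum_swap. apply sum_eq; intros j _.
  rewrite scal_sum. apply sum_eq; intros s _. ring.
Qed.

Section Positivity.
Variables (N : nat) (r phi : nat -> R) (n m : nat).
Hypothesis hr : forall j, 0 <= r j.
Hypothesis hphi : quarter_close N phi.
Hypothesis hm : (n + N <= m)%nat.

(** A surviving term has [|i - j| = |p - q| < N], and then
    [cos (phi i - phi j)] is nonnegative. *)
Lemma cross_term_nonneg i j p q :
  (i <= n)%nat -> (j <= n)%nat -> (p <= N)%nat -> (q <= N)%nat ->
  (p < N + q)%nat -> (q < N + p)%nat ->
  0 <= r i * r j *
    sum_f_R0 (fun s => cos (phi i - phi j + (INR i - INR j) * root_angle m s) *
                     cos ((INR p - INR q) * root_angle m s)) m.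
Proof.
  intros. apply Rmult_le_pos; [apply Rmult_le_pos; apply hr|].
  rewrite cross_term_sum by lia.
  assert (0 < INR (S m)) by (apply lt_0_INR; lia).
  assert (H7 : (i + p = j + q \/ i + q = j + p)%nat -> 0 <= INR (S m) * cos (phi i - phi j)).
  { intros. apply Rmult_le_pos; [lra|]. apply hphi; lia. }
  destruct (Nat.eq_dec (i + p) (j + q)), (Nat.eq_dec (i + q) (j + p)); try lra;
    specialize (H7 ltac:(lia)); lra.
Qed.

Lemma moment_cos_nonneg p q :
  (p <= N)%nat -> (q <= N)%nat -> (p < N + q)%nat -> (q < N + p)%nat ->
  0 <= moment r phi n m (fun t => cos ((INR p - INR q) * t)).
Proof.
  intros. rewrite moment_cos. apply sum_nonneg; intros i hi.
  apply sum_nonneg; intros j hj. apply cross_term_nonneg; assumption.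
Qed.

(** Parseval would give equality with the sum of all [r_k ^ 2]; one diagonal
    term suffices, the others being nonnegative. *)
Lemma moment_one_ge k : (k <= n)%nat -> (0 < N)%nat ->
  INR (S m) * r k ^ 2 <= moment r phi n m (fun _ => 1).
Proof.
  intros hk hN.
  rewrite (moment_ext r phi n m (fun _ => 1) (fun t => cos ((INR 0 - INR 0) * t))).
  2:{ intros t. replace ((INR 0 - INR 0) * t) with 0 by ring. now rewrite cos_0. }
  rewrite moment_cos.
  eapply Rle_trans; [|apply (sum_ge_term _ n k hk)].
  2:{ intros i hi. apply sum_nonneg; intros j hj. apply cross_term_nonneg; lia. }
  eapply Rle_trans; [|apply (sum_ge_term _ n k hk)].
  2:{ intros j hj. apply cross_term_nonneg; lia. }
  cbv beta. rewrite cross_term_sum by lia.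
  destruct (Nat.eq_dec (k + 0) (k + 0)); [|lia].
  replace (phi k - phi k) with 0 by ring. rewrite cos_0. right. field.
Qed.
End Positivity.

(** * A kernel with nonnegative coefficients, nonpositive off an arc *)

(** The summand, multiplied by [2 (cos t - cos al)], is the increment in [j] of
    the Casoratian of [sin (j al)] and [cos (x + j t)], which solve
    [y_{j+1} + y_{j-1} = 2 cos(al) y_j] and [y_{j+1} + y_{j-1} = 2 cos(t) y_j]. *)
Lemma christoffel_darboux (al x t : R) (L : nat) :
  2 * (cos t - cos al) * sum_f_R0 (fun j => sin (INR j * al) * cos (x + INR j * t)) L =
  sin (INR L * al) * cos (x + INR (S L) * t) -
  sin (INR (S L) * al) * cos (x + INR L * t) + sin al * cos x.
Proof.
  induction L as [|L IH].
  - simpl sum_f_R0. simpl INR. rewrite !Rmult_1_l, !Rmult_0_l, sin_0, !Rplus_0_r. ring.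
  - rewrite tech5, Rmult_plus_distr_l, IH.
    rewrite (S_INR (S L)). set (u := INR (S L)).
    replace (INR L) with (u - 1) by (unfold u; rewrite S_INR; ring).
    replace ((u - 1) * al) with (u * al - al) by ring.
    replace ((u + 1) * al) with (u * al + al) by ring.
    replace (x + (u - 1) * t) with ((x + u * t) - t) by ring.
    replace (x + (u + 1) * t) with ((x + u * t) + t) by ring.
    generalize (x + u * t) (u * al). intros y b.
    rewrite sin_minus, sin_plus, cos_minus, cos_plus. ring.
Qed.

(** With [al = PI / N] the weights [sin (j al)] vanish at both ends [0] and [N],
    so that [cos t - cos al] annihilates them except for two boundary terms
    with positive coefficient. *)
Lemma sine_taper_eigen (L : nat) (x t : R) :
  let al := PI / INR (S L) in
  (cos t - cos al) * sum_f_R0 (fun j => sin (INR j * al) * cos (x + INR j * t)) L =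
  sin al / 2 * (cos (x + INR (S L) * t) + cos x).
Proof.
  intro al.
  assert (hL : INR (S L) <> 0) by (apply not_0_INR; lia).
  assert (e : INR (S L) * al = PI) by (unfold al; field; auto).
  assert (e' : INR L * al = PI - al) by (rewrite S_INR in e; lra).
  assert (H := christoffel_darboux al x t L).
  rewrite e, e', sin_PI, sin_minus, sin_PI, cos_PI in H. lra.
Qed.

(** The Fejer-type kernel [|sum_{0 <= j < N} sin (j PI / N) e^{ijt}|^2]. *)
Definition taper (N : nat) (t : R) : R :=
  sqmod (fun j => sin (INR j * (PI / INR N))) (fun _ => 0) (pred N) t.

Lemma taper_le (N : nat) (t : R) : (0 < N)%nat -> taper N t <= 2 * INR N ^ 2.
Proof.
  intros hN. unfold taper, sqmod.
  assert (H : forall f, (forall j, Rabs (f j) <= 1) ->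
     (sum_f_R0 f (pred N)) ^ 2 <= INR N ^ 2).
  { intros f hf. rewrite <- !Rsqr_pow2. apply Rsqr_le_abs_1.
    rewrite (Rabs_pos_eq (INR N)) by apply pos_INR.
    eapply Rle_trans; [apply Rsum_abs|].
    eapply Rle_trans; [apply sum_Rle; intros; apply hf|].
    rewrite sum_cte. replace (S (pred N)) with N by lia. lra. }
  assert (Hm : forall a b, Rabs a <= 1 -> Rabs b <= 1 -> Rabs (a * b) <= 1).
  { intros a b h1 h2. rewrite Rabs_mult. assert (h3 := Rabs_pos a). assert (h4 := Rabs_pos b). nra. }
  assert (Hs : forall y, Rabs (sin y) <= 1) by (intro; apply Rabs_le; apply SIN_bound).
  assert (Hc : forall y, Rabs (cos y) <= 1) by (intro; apply Rabs_le; apply COS_bound).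
  match goal with |- ?A ^ 2 + ?B ^ 2 <= _ =>
    assert (A ^ 2 <= INR N ^ 2) by (apply H; intro; apply Hm; auto);
    assert (B ^ 2 <= INR N ^ 2) by (apply H; intro; apply Hm; auto) end.
  lra.
Qed.

Lemma taper_step_range (N : nat) : (2 <= N)%nat -> 0 < PI / INR N <= PI / 2.
Proof.
  intros hN. assert (2 <= INR N) by (apply (le_INR 2); lia).
  assert (h := PI_RGT_0). split; [apply Rdiv_lt_0_compat; lra|].
  apply Rmult_le_compat_l; [lra|]. apply Rinv_le_contravar; lra.
Qed.

Lemma taper_weight_nonneg (N k : nat) :
  (2 <= N)%nat -> (k <= N)%nat -> 0 <= sin (INR k * (PI / INR N)).
Proof.
  intros hN hk. assert (h := taper_step_range N hN).
  assert (0 < INR N) by (apply lt_0_INR; lia).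
  assert (INR k <= INR N) by (apply le_INR; lia).
  assert (INR N * (PI / INR N) = PI) by (field; lra).
  assert (h0 := pos_INR k). apply sin_ge_0; nra.
Qed.

Section Arc.
Variables (N : nat) (r phi : nat -> R) (n m : nat).
Hypothesis hN : (2 <= N)%nat.
Hypothesis hr : forall j, 0 <= r j.
Hypothesis hphi : quarter_close N phi.
Hypothesis hm : (n + N <= m)%nat.

Let al := PI / INR N.

(** Only frequencies smaller than [N], with nonnegative weights: the frequency
    [N], which occurs at [k = 0], has the weight [sin 0 = 0]. *)
Lemma moment_taper_decomp :
  moment r phi n m (fun t => taper N t * (cos t - cos al)) =
  sin al / 2 *
   sum_f_R0 (fun k => sin (INR k * al) *
     (moment r phi n m (fun t => cos ((INR N - INR k) * t)) +
      moment r phi n m (fun t => cos ((INR 0 - INR k) * t)))) (pred N).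
Proof.
  rewrite (moment_ext r phi n m _ (fun t => sin al / 2 *
     sum_f_R0 (fun k => sin (INR k * al) *
       (cos ((INR N - INR k) * t) + cos ((INR 0 - INR k) * t))) (pred N))).
  - rewrite moment_scal, moment_sum. f_equal. apply sum_eq; intros k _.
    rewrite moment_scal, moment_plus. reflexivity.
  - intro t. unfold taper. rewrite sqmod_double_sum, Rmult_comm, scal_sum, scal_sum.
    apply sum_eq; intros k _.
    assert (H := sine_taper_eigen (pred N) (- INR k * t) t). cbv zeta in H.
    replace (S (pred N)) with N in H by lia. fold al in H. fold al.
    transitivity (sin (INR k * al) * ((cos t - cos al) *
      sum_f_R0 (fun j => sin (INR j * al) * cos (- INR k * t + INR j * t)) (pred N))).
    + rewrite !scal_sum, Rmult_comm, !scal_sum. apply sum_eq; intros j _.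
      replace (0 - 0 + (INR k - INR j) * t) with (- (- INR k * t + INR j * t)) by ring.
      rewrite cos_neg. ring.
    + rewrite H. replace (- INR k * t + INR N * t) with ((INR N - INR k) * t) by ring.
      replace (- INR k * t) with ((INR 0 - INR k) * t) by (simpl; ring). ring.
Qed.

Lemma moment_taper_nonneg :
  0 <= moment r phi n m (fun t => taper N t * (cos t - cos al)).
Proof.
  rewrite moment_taper_decomp. apply Rmult_le_pos.
  - assert (h := taper_weight_nonneg N 1 hN ltac:(lia)).
    rewrite Rmult_1_l in h. fold al in h. lra.
  - apply sum_nonneg; intros k hk.
    destruct (Nat.eq_dec k 0) as [->|ne].
    + simpl INR at 1. rewrite Rmult_0_l, sin_0. lra.
    + apply Rmult_le_pos; [apply taper_weight_nonneg; lia|].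
      apply Rplus_le_le_0_compat; apply (moment_cos_nonneg N); auto; lia.
Qed.

Lemma moment_taper_ge k : (k <= n)%nat ->
  sin al ^ 2 * (INR (S m) * r k ^ 2) <= moment r phi n m (taper N).
Proof.
  intros hk.
  rewrite (moment_ext r phi n m (taper N) (fun t =>
     sum_f_R0 (fun i => sum_f_R0 (fun j => sin (INR i * al) * sin (INR j * al) *
        cos ((INR i - INR j) * t)) (pred N)) (pred N))).
  2:{ intro t. unfold taper. rewrite sqmod_double_sum. fold al.
      apply sum_eq; intros i _. apply sum_eq; intros j _. f_equal. f_equal. ring. }
  rewrite moment_sum.
  assert (pos : forall i j, (i <= pred N)%nat -> (j <= pred N)%nat ->
    0 <= moment r phi n m (fun t => sin (INR i * al) * sin (INR j * al) * cos ((INR i - INR j) * t))).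
  { intros i j hi hj. rewrite moment_scal.
    apply Rmult_le_pos; [apply Rmult_le_pos; apply taper_weight_nonneg; lia|].
    apply (moment_cos_nonneg N); auto; lia. }
  eapply Rle_trans; [|apply (sum_ge_term _ (pred N) 1); [lia|]].
  2:{ intros i hi. cbv beta. rewrite moment_sum. apply sum_nonneg; intros j hj. auto. }
  cbv beta. rewrite moment_sum.
  eapply Rle_trans; [|apply (sum_ge_term _ (pred N) 1); [lia|]].
  2:{ intros j hj. apply pos; lia. }
  cbv beta. rewrite moment_scal, ! Rmult_1_l.
  replace (sin al ^ 2) with (sin al * sin al) by ring.
  apply Rmult_le_compat_l; [nra|].
  rewrite (moment_ext _ _ _ _ _ (fun _ => 1)).
  - apply (moment_one_ge N); auto; lia.
  - intro t. replace ((INR 1 - INR 1) * t) with 0 by ring. apply cos_0.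
Qed.
End Arc.

(** The test function [taper N t * (cos t - cos be)], [be = 2 PI / N], is
    nonpositive off the arc [cos be <= cos t], so its moment is at most a
    multiple of the bound of [|P|^2] on the arc.  Written as
    [taper N t * (cos t - cos al) + (cos al - cos be) * taper N t] it is a
    nonnegative combination of cosines of frequency less than [N] in which the
    constant term has a positive coefficient, so its moment also dominates
    every [r_k ^ 2]. *)
Lemma coefficient_bound_by_arc (N : nat) (hN : (2 <= N)%nat) :
  exists C, 0 <= C /\ forall (r phi : nat -> R) (n k : nat) (B : R),
    (forall j, 0 <= r j) -> quarter_close N phi -> (k <= n)%nat ->
    (forall t, cos (2 * (PI / INR N)) <= cos t -> sqmod r phi n t <= B) ->
    r k ^ 2 <= C * B.
Proof.
  set (al := PI / INR N). set (be := 2 * al).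
  assert (hal := taper_step_range N hN : 0 < al <= PI / 2).
  assert (hpi := PI_RGT_0).
  assert (hs : 0 < sin al) by (apply sin_gt_0; lra).
  assert (hcc : cos be < cos al) by (apply cos_decreasing_1; unfold be; lra).
  assert (hN2 : 0 < INR N) by (apply lt_0_INR; lia).
  set (c := (cos al - cos be) * sin al ^ 2).
  assert (hc : 0 < c) by (unfold c; apply Rmult_lt_0_compat; [lra|apply pow_lt; lra]).
  exists (4 * INR N ^ 2 / c). split.
  { apply Rdiv_le_0_compat; [|lra]. assert (h := pow2_ge_0 (INR N)). lra. }
  intros r phi n k B hr hphi hk hB.
  assert (hB0 : 0 <= B).
  { eapply Rle_trans; [apply (sqmod_nonneg r phi n 0)|apply hB].
    rewrite cos_0. apply COS_bound. }
  set (m := (n + N)%nat).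
  assert (hm : 0 < INR (S m)) by (apply lt_0_INR; lia).
  assert (low : c * (INR (S m) * r k ^ 2) <=
      moment r phi n m (fun t => taper N t * (cos t - cos be))).
  { rewrite (moment_ext _ _ _ _ _ (fun t => taper N t * (cos t - cos al) +
       (cos al - cos be) * taper N t)) by (intro; ring).
    rewrite moment_plus, moment_scal.
    assert (h1 := moment_taper_nonneg N r phi n m hN hr hphi (le_n _)).
    assert (h2 := moment_taper_ge N r phi n m hN hr hphi (le_n _) k hk).
    fold al in h1, h2. unfold c.
    apply (Rmult_le_compat_l (cos al - cos be)) in h2; [|lra]. lra. }
  assert (up : moment r phi n m (fun t => taper N t * (cos t - cos be)) <=
      INR (S m) * (4 * INR N ^ 2 * B)).
  { unfold moment. eapply Rle_trans.
    - apply sum_Rle with (Bn := fun _ => 4 * INR N ^ 2 * B). intros s _.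
      set (t := root_angle m s).
      assert (h1 := sqmod_nonneg r phi n t).
      assert (h2 : 0 <= taper N t) by apply sqmod_nonneg.
      assert (h3 := taper_le N t ltac:(lia)).
      assert (h4 := COS_bound t). assert (h5 := COS_bound be).
      destruct (Rle_dec (cos be) (cos t)) as [le|nle].
      + assert (h6 := hB t le).
        assert (taper N t * (cos t - cos be) <= 2 * INR N ^ 2 * 2)
          by (apply Rmult_le_compat; lra).
        assert (0 <= taper N t * (cos t - cos be)) by (apply Rmult_le_pos; lra).
        rewrite (Rmult_comm (4 * _)).
        apply Rmult_le_compat; lra.
      + apply Rle_trans with 0.
        * assert (0 <= sqmod r phi n t * taper N t) by (apply Rmult_le_pos; lra).
          nra.
        * apply Rmult_le_pos; [|lra]. assert (h := pow2_ge_0 (INR N)). lra.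
    - rewrite sum_cte. right; ring. }
  apply Rmult_le_reg_l with c; [lra|].
  replace (c * (4 * INR N ^ 2 / c * B)) with (4 * INR N ^ 2 * B) by (field; lra).
  apply Rmult_le_reg_l with (INR (S m)); lra.
Qed.

(** * Goursat's theorem for divergence-free fields *)

Lemma halving_small (h d : R) : 0 < d ->
  exists n, forall m, (n <= m)%nat -> Rabs (h / 2 ^ m) < d.
Proof.
  intros hd.
  destruct (pow_lt_1_zero (/ 2) ltac:(rewrite Rabs_pos_eq; lra) (d / (Rabs h + 1))) as [n hn].
  { apply Rdiv_lt_0_compat; [lra|]. assert (H := Rabs_pos h). lra. }
  exists n. intros m hm. specialize (hn m hm).
  assert (H := Rabs_pos h).
  rewrite pow_inv in hn. unfold Rdiv at 1. rewrite Rabs_mult.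
  apply Rle_lt_trans with ((Rabs h + 1) * Rabs (/ 2 ^ m)).
  - apply Rmult_le_compat_r; [apply Rabs_pos|lra].
  - apply (Rmult_lt_compat_l (Rabs h + 1)) in hn; [|lra].
    replace ((Rabs h + 1) * (d / (Rabs h + 1))) with d in hn by (field; lra). lra.
Qed.

Lemma nested_halving (u : nat -> R) (h : R) :
  (forall n, u n <= u (S n)) ->
  (forall n, u (S n) + h / 2 ^ S n <= u n + h / 2 ^ n) ->
  exists l, forall n, u n <= l <= u n + h / 2 ^ n.
Proof.
  intros h1 h2. set (v := fun n => u n + h / 2 ^ n).
  assert (hl : is_lim_seq (fun n => v n - u n) 0).
  { apply is_lim_seq_spec. intros eps.
    destruct (halving_small h eps (cond_pos eps)) as [n hn].
    exists n. intros m hm. unfold v.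
    replace (u m + h / 2 ^ m - u m - 0) with (h / 2 ^ m) by ring. auto. }
  destruct (ex_lim_seq_adj u v h1 h2 hl) as [[l hu] [[l' hv] e]].
  rewrite (is_lim_seq_unique _ _ hu), (is_lim_seq_unique _ _ hv) in e.
  injection e as <-.
  exists l. intro n. split.
  - apply (is_lim_seq_incr_compare u); assumption.
  - apply (is_lim_seq_decr_compare v); assumption.
Qed.

Section Bisection.
Variable P : nat -> R -> R -> Prop.
Variables h k : R.
Hypothesis dec : forall n x y, {P n x y} + {~ P n x y}.
Hypothesis h0 : 0 <= h.
Hypothesis k0 : 0 <= k.

Let corner (x0 y0 : R) := fix corner (n : nat) : R * R :=
  match n with
  | O => (x0, y0)
  | S n' =>
      let x := fst (corner n') in
      let y := snd (corner n') in
      if dec n x y then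
        if dec n (x + h / 2 ^ n) y then
          if dec n x (y + k / 2 ^ n) then (x + h / 2 ^ n, y + k / 2 ^ n)
          else (x, y + k / 2 ^ n)
        else (x + h / 2 ^ n, y)
      else (x, y)
  end.

(** Bisection of a rectangle with sides [h] and [k], a Cousin lemma for dyadic
    subrectangles: if [P] failed for the whole rectangle, it would fail for a
    nested sequence of quarters shrinking to a point. *)
Lemma rectangle_induction (x0 y0 : R) :
  (forall n x y,
     x0 <= x -> x + h / 2 ^ n <= x0 + h -> y0 <= y -> y + k / 2 ^ n <= y0 + k ->
     P (S n) x y -> P (S n) (x + h / 2 ^ S n) y ->
     P (S n) x (y + k / 2 ^ S n) -> P (S n) (x + h / 2 ^ S n) (y + k / 2 ^ S n) ->
     P n x y) ->
  (forall p q, x0 <= p <= x0 + h -> y0 <= q <= y0 + k ->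
     exists d, 0 < d /\ forall n x y, h / 2 ^ n < d -> k / 2 ^ n < d ->
       x0 <= x -> x + h / 2 ^ n <= x0 + h -> y0 <= y -> y + k / 2 ^ n <= y0 + k ->
       x <= p <= x + h / 2 ^ n -> y <= q <= y + k / 2 ^ n -> P n x y) ->
  P 0%nat x0 y0.
Proof.
  intros glue loc.
  destruct (dec 0 x0 y0) as [ok|bad]; [exact ok|exfalso].
  set (X := fun n => fst (corner x0 y0 n)). set (Y := fun n => snd (corner x0 y0 n)).
  assert (half : forall (w : R) n, w / 2 ^ n = w / 2 ^ S n + w / 2 ^ S n).
  { intros w n. simpl. field. apply pow_nonzero. lra. }
  assert (pos : forall (w : R) n, 0 <= w -> 0 <= w / 2 ^ n).
  { intros w n hw. apply Rdiv_le_0_compat; [lra|apply pow_lt; lra]. }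
  assert (step : forall n,
    (X n <= X (S n) /\ X (S n) + h / 2 ^ S n <= X n + h / 2 ^ n) /\
    (Y n <= Y (S n) /\ Y (S n) + k / 2 ^ S n <= Y n + k / 2 ^ n)).
  { intro n. assert (a1 := half h n). assert (a2 := half k n).
    assert (a3 := pos h (S n) h0). assert (a4 := pos k (S n) k0).
    unfold X, Y. cbn [corner].
    change (fst (corner x0 y0 n)) with (X n). change (snd (corner x0 y0 n)) with (Y n).
    destruct (dec _ _ _); [|cbn [fst snd]; lra].
    destruct (dec _ _ _); [|cbn [fst snd]; lra].
    destruct (dec _ _ _); cbn [fst snd]; lra. }
  assert (inside : forall n, (x0 <= X n /\ X n + h / 2 ^ n <= x0 + h) /\
                             (y0 <= Y n /\ Y n + k / 2 ^ n <= y0 + k)).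
  { induction n as [|n IH].
    - unfold X, Y. simpl. lra.
    - specialize (step n). lra. }
  assert (fail : forall n, ~ P n (X n) (Y n)).
  { induction n as [|n IH]; [exact bad|].
    destruct (inside n) as [[i1 i2] [i3 i4]].
    unfold X, Y. cbn [corner].
    change (fst (corner x0 y0 n)) with (X n). change (snd (corner x0 y0 n)) with (Y n).
    destruct (dec (S n) (X n) (Y n)) as [p1|]; [|assumption].
    destruct (dec (S n) (X n + h / 2 ^ S n) (Y n)) as [p2|]; [|assumption].
    destruct (dec (S n) (X n) (Y n + k / 2 ^ S n)) as [p3|]; [|assumption].
    cbn [fst snd]. intro p4. apply IH, glue; assumption. }
  destruct (nested_halving X h) as [p hp]; [intro n; apply step..|].
  destruct (nested_halving Y k) as [q hq]; [intro n; apply step..|].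
  destruct (loc p q) as [d [hd hloc]].
  { specialize (hp 0%nat). destruct (inside 0%nat). lra. }
  { specialize (hq 0%nat). destruct (inside 0%nat). lra. }
  destruct (halving_small h d hd) as [n1 hn1].
  destruct (halving_small k d hd) as [n2 hn2].
  set (n := max n1 n2).
  apply (fail n). destruct (inside n) as [[i1 i2] [i3 i4]].
  apply hloc; auto.
  - specialize (hn1 n ltac:(lia)). apply Rabs_def2 in hn1. lra.
  - specialize (hn2 n ltac:(lia)). apply Rabs_def2 in hn2. lra.
Qed.
End Bisection.

(** [u] and [v] are differentiable at [(x, y)] and [du/dx = dv/dy] there: the
    plane field [(u, - v)] has divergence zero.  The condition is pointwise: the partial
    derivatives may be discontinuous. *)
Definition divergence_free_at (u v : R -> R -> R) (x y : R) : Prop :=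
  exists A B D, forall eps, 0 < eps -> exists d, 0 < d /\
    forall x' y', Rabs (x' - x) < d -> Rabs (y' - y) < d ->
      Rabs (u x' y' - u x y - (A * (x' - x) + B * (y' - y)))
        <= eps * (Rabs (x' - x) + Rabs (y' - y)) /\
      Rabs (v x' y' - v x y - (D * (x' - x) + A * (y' - y)))
        <= eps * (Rabs (x' - x) + Rabs (y' - y)).

Lemma continuous_of_increment (f : R -> R) (x M d : R) :
  0 < d -> (forall x', Rabs (x' - x) < d -> Rabs (f x' - f x) <= M * Rabs (x' - x)) ->
  continuous f x.
Proof.
  intros hd H. apply filterlim_locally. intros eps.
  assert (hM : 0 < Rabs M + 1) by (assert (h := Rabs_pos M); lra).
  assert (hpos : 0 < Rmin d (eps / (Rabs M + 1))).
  { apply Rmin_glb_lt; [lra|]. apply Rdiv_lt_0_compat; [apply cond_pos|lra]. }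
  exists (mkposreal _ hpos). intros y hy.
  change (Rabs (y - x) < Rmin d (eps / (Rabs M + 1))) in hy.
  change (Rabs (f y - f x) < eps).
  assert (h1 := Rlt_le_trans _ _ _ hy (Rmin_l _ _)).
  assert (h2 := Rlt_le_trans _ _ _ hy (Rmin_r _ _)).
  apply Rle_lt_trans with (1 := H y h1).
  apply Rle_lt_trans with ((Rabs M + 1) * Rabs (y - x)).
  - apply Rmult_le_compat_r; [apply Rabs_pos|]. assert (h := Rle_abs M). lra.
  - apply (Rmult_lt_compat_l (Rabs M + 1)) in h2; [|lra].
    replace ((Rabs M + 1) * (eps / (Rabs M + 1))) with (pos eps) in h2 by (field; lra). lra.
Qed.

Lemma divergence_free_continuous (u v : R -> R -> R) (x y : R) :
  divergence_free_at u v x y ->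
  continuous (u x) y /\ continuous (fun x' => v x' y) x.
Proof.
  intros [A [B [D H]]]. destruct (H 1 Rlt_0_1) as [d [hd Hd]].
  assert (z : Rabs 0 = 0) by apply Rabs_R0.
  split.
  - apply continuous_of_increment with (Rabs B + 1) d; [exact hd|]. intros y' hy'.
    destruct (Hd x y') as [h _]; [rewrite Rminus_diag, z; lra|assumption|].
    rewrite Rminus_diag, z, Rmult_0_r, !Rplus_0_l, Rmult_1_l in h.
    replace (u x y' - u x y) with ((u x y' - u x y - B * (y' - y)) + B * (y' - y)) by ring.
    eapply Rle_trans; [apply Rabs_triang|]. rewrite Rabs_mult. lra.
  - apply continuous_of_increment with (Rabs D + 1) d; [exact hd|]. intros x' hx'.
    destruct (Hd x' y) as [_ h]; [assumption|rewrite Rminus_diag, z; lra|].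
    rewrite Rminus_diag, z, Rmult_0_r, !Rplus_0_r, Rmult_1_l in h.
    replace (v x' y - v x y) with ((v x' y - v x y - D * (x' - x)) + D * (x' - x)) by ring.
    eapply Rle_trans; [apply Rabs_triang|]. rewrite Rabs_mult. lra.
Qed.

(** Outward flux of [(u, - v)] through the boundary of [[a, b] x [c, d]]. *)
Definition flux (u v : R -> R -> R) (a b c d : R) : R :=
  (RInt (u b) c d - RInt (u a) c d) -
  (RInt (fun x => v x d) a b - RInt (fun x => v x c) a b).

Lemma ex_RInt_on (f : R -> R) (a b a' b' : R) : a <= a' -> a' <= b' -> b' <= b ->
  (forall x, a <= x <= b -> continuous f x) -> ex_RInt f a' b'.
Proof.
  intros h1 h2 h3 hf. apply (ex_RInt_continuous (V := R_CompleteNormedModule)). intros z hz.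
  rewrite Rmin_left, Rmax_right in hz by lra. apply hf. lra.
Qed.

Lemma RInt_near_const (f g : R -> R) (a b c e : R) :
  a <= b -> ex_RInt f a b -> ex_RInt g a b ->
  (forall x, a <= x <= b -> Rabs (f x - g x - c) <= e) ->
  Rabs (RInt f a b - RInt g a b - c * (b - a)) <= e * (b - a).
Proof.
  intros hab hf hg H.
  assert (hfg : ex_RInt (fun x => f x - g x) a b) by (apply (@ex_RInt_minus R_NormedModule); auto).
  assert (E : RInt (fun x => f x - g x - c) a b = RInt f a b - RInt g a b - c * (b - a)).
  { rewrite (RInt_minus (V := R_CompleteNormedModule) (fun x => f x - g x) (fun _ => c));
      [|exact hfg|apply ex_RInt_const].
    rewrite (RInt_minus (V := R_CompleteNormedModule) f g) by assumption.
    rewrite RInt_const. unfold minus, plus, opp, scal; simpl. unfold mult; simpl. ring. }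
  rewrite <- E, (Rmult_comm e). apply abs_RInt_le_const; [exact hab| |exact H].
  apply (@ex_RInt_minus R_NormedModule); [exact hfg|apply ex_RInt_const].
Qed.

Section Divergence.
Variables (u v : R -> R -> R) (a b c d : R).
Hypothesis H : forall x y, a <= x <= b -> c <= y <= d -> divergence_free_at u v x y.

Lemma ex_RInt_u x y y' : a <= x <= b -> c <= y -> y <= y' -> y' <= d -> ex_RInt (u x) y y'.
Proof.
  intros. apply ex_RInt_on with c d; auto. intros z hz.
  apply (divergence_free_continuous u v x z). auto.
Qed.

Lemma ex_RInt_v y x x' : c <= y <= d -> a <= x -> x <= x' -> x' <= b ->
  ex_RInt (fun t => v t y) x x'.
Proof.
  intros. apply ex_RInt_on with a b; auto. intros z hz.
  apply (divergence_free_continuous u v z y). auto.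
Qed.

Lemma flux_split x1 x2 x3 y1 y2 y3 :
  a <= x1 -> x1 <= x2 -> x2 <= x3 -> x3 <= b ->
  c <= y1 -> y1 <= y2 -> y2 <= y3 -> y3 <= d ->
  flux u v x1 x3 y1 y3 =
  flux u v x1 x2 y1 y2 + flux u v x2 x3 y1 y2 +
  flux u v x1 x2 y2 y3 + flux u v x2 x3 y2 y3.
Proof.
  intros. unfold flux.
  assert (Cu : forall x, a <= x <= b -> RInt (u x) y1 y2 + RInt (u x) y2 y3 = RInt (u x) y1 y3).
  { intros. apply (RInt_Chasles (V := R_CompleteNormedModule)); apply ex_RInt_u; lra. }
  assert (Cv : forall y, c <= y <= d -> RInt (fun t => v t y) x1 x2 + RInt (fun t => v t y) x2 x3
     = RInt (fun t => v t y) x1 x3).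
  { intros. apply (RInt_Chasles (V := R_CompleteNormedModule)); apply ex_RInt_v; lra. }
  assert (e1 := Cu x1 ltac:(lra)). assert (e2 := Cu x3 ltac:(lra)).
  assert (e3 := Cv y1 ltac:(lra)). assert (e4 := Cv y3 ltac:(lra)).
  lra.
Qed.

(** The affine part of the field at [(p, q)] has flux zero, and the remainder is
    at most [eps * (s + t)] on a boundary of length [2 (s + t)]. *)
Lemma flux_small eps p q : 0 < eps -> a <= p <= b -> c <= q <= d ->
  exists del, 0 < del /\ forall x y s t, 0 <= s < del -> 0 <= t < del ->
    a <= x -> x + s <= b -> c <= y -> y + t <= d ->
    x <= p <= x + s -> y <= q <= y + t ->
    Rabs (flux u v x (x + s) y (y + t)) <= 2 * eps * (s + t) ^ 2.
Proof.
  intros he hp hq. destruct (H p q hp hq) as [A [B [D Hd]]].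
  destruct (Hd eps he) as [del [hdel E]]. exists del. split; [exact hdel|].
  intros x y s t hs ht hx hxs hy hyt hxp hyq.
  assert (E' : forall x' y', x <= x' <= x + s -> y <= y' <= y + t ->
     Rabs (u x' y' - u p q - (A * (x' - p) + B * (y' - q))) <= eps * (s + t) /\
     Rabs (v x' y' - v p q - (D * (x' - p) + A * (y' - q))) <= eps * (s + t)).
  { intros x' y' hx' hy'.
    assert (r1 : Rabs (x' - p) <= s) by (apply Rabs_le; lra).
    assert (r2 : Rabs (y' - q) <= t) by (apply Rabs_le; lra).
    destruct (E x' y'); [lra..|].
    assert (eps * (Rabs (x' - p) + Rabs (y' - q)) <= eps * (s + t))
      by (apply Rmult_le_compat_l; lra). lra. }
  assert (Fu : Rabs (RInt (u (x + s)) y (y + t) - RInt (u x) y (y + t) - A * s * (y + t - y))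
     <= 2 * eps * (s + t) * (y + t - y)).
  { apply RInt_near_const; [lra|apply ex_RInt_u; lra..|]. intros z hz.
    destruct (E' (x + s) z) as [h1 _]; [lra..|]. destruct (E' x z) as [h2 _]; [lra..|].
    apply Rabs_le_between in h1, h2. apply Rabs_le. lra. }
  assert (Fv : Rabs (RInt (fun z => v z (y + t)) x (x + s) - RInt (fun z => v z y) x (x + s)
      - A * t * (x + s - x)) <= 2 * eps * (s + t) * (x + s - x)).
  { apply RInt_near_const; [lra|apply ex_RInt_v; lra..|]. intros z hz.
    destruct (E' z (y + t)) as [_ h1]; [lra..|]. destruct (E' z y) as [_ h2]; [lra..|].
    apply Rabs_le_between in h1, h2. apply Rabs_le. lra. }
  unfold flux. apply Rabs_le_between in Fu, Fv. apply Rabs_le. nra.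
Qed.

(** Goursat: halving both sides of a rectangle divides the bound
    [2 eps (h + k)^2] by four, so the bound passes from the four quarters to the
    whole rectangle, for every [eps]. *)
Lemma flux_zero : a <= b -> c <= d -> flux u v a b c d = 0.
Proof.
  intros hab hcd.
  set (h := b - a). set (k := d - c).
  assert (K : forall eps, 0 < eps -> Rabs (flux u v a b c d) <= 2 * eps * (h + k) ^ 2).
  { intros eps he.
    set (P := fun n x y => Rabs (flux u v x (x + h / 2 ^ n) y (y + k / 2 ^ n))
                 <= 2 * eps * (h / 2 ^ n + k / 2 ^ n) ^ 2).
    assert (P0 : P 0%nat a c).
    { apply (rectangle_induction P h k); unfold P.
      - intros. apply Rle_dec.
      - unfold h; lra.
      - unfold k; lra.
      - intros n x y i1 i2 i3 i4 q1 q2 q3 q4.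
        assert (pos : forall w, 0 <= w -> 0 <= w / 2 ^ S n).
        { intros w hw. apply Rdiv_le_0_compat; [lra|apply pow_lt; lra]. }
        assert (a3 := pos h ltac:(unfold h; lra)). assert (a4 := pos k ltac:(unfold k; lra)).
        assert (half : forall w, w / 2 ^ n = w / 2 ^ S n + w / 2 ^ S n).
        { intros w. simpl. field. apply pow_nonzero. lra. }
        rewrite (half h) in i2 |- *. rewrite (half k) in i4 |- *.
        rewrite (Rplus_assoc x) in q2, q4. rewrite (Rplus_assoc y) in q3, q4.
        rewrite (flux_split x (x + h / 2 ^ S n) _ y (y + k / 2 ^ S n));
          try (unfold h, k in *; lra).
        apply Rabs_le_between in q1, q2, q3, q4. apply Rabs_le. lra.
      - intros p q hp hq.
        destruct (flux_small eps p q he) as [del [hdel F]]; [unfold h, k in *; lra..|].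
        exists del. split; [exact hdel|]. intros n x y s1 s2 i1 i2 i3 i4 hpx hqy.
        assert (pos : forall w, 0 <= w -> 0 <= w / 2 ^ n).
        { intros w hw. apply Rdiv_le_0_compat; [lra|apply pow_lt; lra]. }
        assert (a3 := pos h ltac:(unfold h; lra)). assert (a4 := pos k ltac:(unfold k; lra)).
        apply F; unfold h, k in *; lra. }
    unfold P in P0. simpl pow in P0. rewrite !Rdiv_1_r in P0.
    replace (a + h) with b in P0 by (unfold h; ring).
    replace (c + k) with d in P0 by (unfold k; ring). simpl pow. exact P0. }
  apply Rabs_eq_0, Rle_antisym; [|apply Rabs_pos].
  apply le_epsilon. intros e he. rewrite Rplus_0_l.
  assert (hp : 0 < 2 * (h + k) ^ 2 + 1) by (assert (t := pow2_ge_0 (h + k)); lra).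
  eapply Rle_trans; [apply (K (e / (2 * (h + k) ^ 2 + 1))); apply Rdiv_lt_0_compat; lra|].
  replace (2 * (e / (2 * (h + k) ^ 2 + 1)) * (h + k) ^ 2)
    with (e * (2 * (h + k) ^ 2 / (2 * (h + k) ^ 2 + 1))) by (field; lra).
  rewrite <- (Rmult_1_r e) at 2. apply Rmult_le_compat_l; [lra|].
  apply Rle_div_l; lra.
Qed.
End Divergence.

(** * Holomorphic functions in logarithmic coordinates *)

(** Complex differentiability with values in the field [C] regarded as a module
    over itself, where the product and chain rules are available. *)
Definition cdiff (f : C -> C) (z : C) : Prop :=
  @ex_derive C_AbsRing (AbsRing_NormedModule C_AbsRing) f z.

Lemma cdiff_iff (f : C -> C) (z : C) :
  cdiff f z <-> exists l : C, forall eps, 0 < eps -> exists d, 0 < d /\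
    forall w : C, Cmod (w - z) < d ->
      Cmod (f w - f z - (w - z) * l) <= eps * Cmod (w - z).
Proof.
  split; intros [l H]; exists l.
  - destruct H as [_ H]. intros eps he.
    destruct (H z (fun P h => h) (mkposreal eps he)) as [d Hd].
    exists d. split; [apply cond_pos|]. intros w hw. exact (Hd w hw).
  - split; [apply (is_linear_scal_l (V := AbsRing_NormedModule C_AbsRing))|].
    intros x hx.
    apply (is_filter_lim_locally_unique (V := AbsRing_NormedModule C_AbsRing)) in hx.
    subst x. intros eps. destruct (H eps (cond_pos eps)) as [d [hd Hd]].
    exists (mkposreal d hd). intros w hw. exact (Hd w hw).
Qed.

Lemma cdiff_of_ex_derive (f : C -> C) (z : C) :
  @ex_derive C_AbsRing C_NormedModule f z -> cdiff f z.
Proof.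
  intros [l [H1 H2]]. exists l. split; [|exact H2].
  apply (is_linear_scal_l (V := AbsRing_NormedModule C_AbsRing)).
Qed.

Lemma cdiff_const (c z : C) : cdiff (fun _ => c) z.
Proof. apply (ex_derive_const (V := AbsRing_NormedModule C_AbsRing)). Qed.

Lemma cdiff_id (z : C) : cdiff (fun w => w) z.
Proof. exact (ex_derive_id (K := C_AbsRing) z). Qed.

Lemma cdiff_plus (f g : C -> C) (z : C) :
  cdiff f z -> cdiff g z -> cdiff (fun w => f w + g w)%C z.
Proof. apply (ex_derive_plus (V := AbsRing_NormedModule C_AbsRing)). Qed.

Lemma cdiff_mult (f g : C -> C) (z : C) :
  cdiff f z -> cdiff g z -> cdiff (fun w => f w * g w)%C z.
Proof.
  intros [l hl] [m hm]. eexists.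
  apply (is_derive_mult (K := C_AbsRing) f g z l m hl hm). exact Cmult_comm.
Qed.

Lemma cdiff_comp (f g : C -> C) (z : C) :
  cdiff f (g z) -> cdiff g z -> cdiff (fun w => f (g w)) z.
Proof. apply (ex_derive_comp (K := C_AbsRing) (V := AbsRing_NormedModule C_AbsRing)). Qed.

Lemma Cmod_le_abs (z : C) : Cmod z <= Rabs (fst z) + Rabs (snd z).
Proof.
  destruct z as [x y]. simpl fst; simpl snd.
  replace (x, y) with (RtoC x + Ci * RtoC y)%C
    by (unfold Ci, RtoC, Cmult, Cplus; simpl; f_equal; ring).
  eapply Rle_trans; [apply Cmod_triangle|].
  rewrite Cmod_mult, !Cmod_R, Cmod_Ci. lra.
Qed.

Lemma abs_fst_le_Cmod (z : C) : Rabs (fst z) <= Cmod z.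
Proof. eapply Rle_trans; [apply Rmax_l|apply Rmax_Cmod]. Qed.

Lemma abs_snd_le_Cmod (z : C) : Rabs (snd z) <= Cmod z.
Proof. eapply Rle_trans; [apply Rmax_r|apply Rmax_Cmod]. Qed.

(** One of the two Cauchy-Riemann equations. *)
Lemma cdiff_divergence_free (f : C -> C) (x y : R) :
  cdiff f (x, y) ->
  divergence_free_at (fun s t => fst (f (s, t))) (fun s t => snd (f (s, t))) x y.
Proof.
  intros H. apply cdiff_iff in H. destruct H as [[l1 l2] H].
  exists l1, (- l2), l2. intros eps he. destruct (H eps he) as [d [hd Hd]].
  exists (d / 2). split; [lra|]. intros x' y' hx hy.
  assert (e : ((x', y') - (x, y))%C = (x' - x, y' - y)) by reflexivity.
  assert (b := Cmod_le_abs ((x', y') - (x, y))). rewrite e in b. simpl fst in b; simpl snd in b.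
  specialize (Hd (x', y')). rewrite e in Hd. specialize (Hd ltac:(lra)).
  assert (h1 := abs_fst_le_Cmod (f (x', y') - f (x, y) - ((x' - x)%R, (y' - y)%R) * (l1, l2))%C).
  assert (h2 := abs_snd_le_Cmod (f (x', y') - f (x, y) - ((x' - x)%R, (y' - y)%R) * (l1, l2))%C).
  destruct (f (x', y')) as [p' q']. destruct (f (x, y)) as [p q].
  cbn [fst snd Cminus Cplus Copp Cmult] in h1, h2 |- *.
  apply (Rmult_le_compat_l eps) in b; [|lra]. split.
  - replace (p' - p - (l1 * (x' - x) + - l2 * (y' - y)))
      with (p' + - p + - ((x' - x) * l1 - (y' - y) * l2)) by ring. lra.
  - replace (q' - q - (l2 * (x' - x) + l1 * (y' - y)))
      with (q' + - q + - ((x' - x) * l2 + (y' - y) * l1)) by ring. lra.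
Qed.

Definition cexp (z : C) : C := (exp (fst z) * cos (snd z), exp (fst z) * sin (snd z)).

Lemma cexp_plus (z w : C) : cexp (z + w) = (cexp z * cexp w)%C.
Proof.
  unfold cexp, Cmult; simpl. rewrite exp_plus, cos_plus, sin_plus. f_equal; ring.
Qed.

Lemma Cmod_cexp (z : C) : Cmod (cexp z) = exp (fst z).
Proof.
  unfold Cmod, cexp; simpl fst; simpl snd.
  replace ((exp (fst z) * cos (snd z)) ^ 2 + (exp (fst z) * sin (snd z)) ^ 2)
    with (exp (fst z) ^ 2 * (Rsqr (sin (snd z)) + Rsqr (cos (snd z)))) by (unfold Rsqr; ring).
  rewrite sin2_cos2, Rmult_1_r, <- Rsqr_pow2. apply sqrt_Rsqr, Rlt_le, exp_pos.
Qed.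

Lemma increment_of_derivable (f : R -> R) (l : R) : derivable_pt_lim f 0 l ->
  forall eps, 0 < eps -> exists d, 0 < d /\
    forall h, Rabs h < d -> Rabs (f h - f 0 - l * h) <= eps * Rabs h.
Proof.
  intros H eps he. destruct (H eps he) as [d Hd].
  exists d. split; [apply cond_pos|]. intros h hh.
  destruct (Req_dec h 0) as [->|ne].
  - replace (f 0 - f 0 - l * 0) with 0 by ring. rewrite Rabs_R0. lra.
  - specialize (Hd h ne hh). rewrite Rplus_0_l in Hd.
    replace (f h - f 0 - l * h) with (((f h - f 0) / h - l) * h) by (field; exact ne).
    rewrite Rabs_mult. apply Rmult_le_compat_r; [apply Rabs_pos|lra].
Qed.

(** The real and imaginary parts of [cexp h - 1 - h] are
    [(e^x - 1 - x) + e^x (cos y - 1)] and [(e^x - 1) sin y + (sin y - y)]. *)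
Lemma cexp_increment (eps : R) : 0 < eps -> exists d, 0 < d /\
  forall h : C, Cmod h < d -> Cmod (cexp h - 1 - h) <= eps * Cmod h.
Proof.
  intros he. set (e := Rmin 1 (eps / 9)).
  assert (he0 : 0 < e) by (apply Rmin_glb_lt; lra).
  assert (he1 : e <= 1) by apply Rmin_l.
  assert (he9 : e <= eps / 9) by apply Rmin_r.
  destruct (increment_of_derivable exp 1 derivable_pt_lim_exp_0 e he0) as [d1 [hd1 H1]].
  destruct (increment_of_derivable cos _ (derivable_pt_lim_cos 0) e he0) as [d2 [hd2 H2]].
  destruct (increment_of_derivable sin _ (derivable_pt_lim_sin 0) e he0) as [d3 [hd3 H3]].
  exists (Rmin e (Rmin d1 (Rmin d2 d3))). split.
  { repeat (apply Rmin_glb_lt; [assumption|]). assumption. }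
  intros [x y] hh.
  assert (g1 := Rlt_le_trans _ _ _ hh (Rmin_l _ _)).
  assert (hh2 := Rlt_le_trans _ _ _ hh (Rmin_r _ _)).
  assert (g2 := Rlt_le_trans _ _ _ hh2 (Rmin_l _ _)).
  assert (hh3 := Rlt_le_trans _ _ _ hh2 (Rmin_r _ _)).
  assert (g3 := Rlt_le_trans _ _ _ hh3 (Rmin_l _ _)).
  assert (g4 := Rlt_le_trans _ _ _ hh3 (Rmin_r _ _)).
  assert (hx := abs_fst_le_Cmod (x, y)). assert (hy := abs_snd_le_Cmod (x, y)).
  simpl fst in hx; simpl snd in hy. set (m := Cmod (x, y)) in *.
  specialize (H1 x ltac:(lra)). specialize (H2 y ltac:(lra)). specialize (H3 y ltac:(lra)).
  rewrite exp_0, Rmult_1_l in H1. rewrite cos_0, sin_0 in H2. rewrite sin_0, cos_0 in H3.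
  rewrite Rmult_1_l in H3.
  replace (cos y - 1 - - 0 * y) with (cos y - 1) in H2 by ring.
  rewrite Rminus_0_r in H3.
  assert (px := Rabs_pos x). assert (py := Rabs_pos y).
  assert (k1 : Rabs (exp x - 1) <= 2 * Rabs x).
  { replace (exp x - 1) with ((exp x - 1 - x) + x) by ring.
    eapply Rle_trans; [apply Rabs_triang|]. nra. }
  assert (k2 : Rabs (sin y) <= 2 * Rabs y).
  { replace (sin y) with ((sin y - y) + y) by ring.
    eapply Rle_trans; [apply Rabs_triang|]. nra. }
  assert (k3 : Rabs (exp x) <= 3).
  { replace (exp x) with ((exp x - 1) + 1) by ring.
    eapply Rle_trans; [apply Rabs_triang|]. rewrite Rabs_R1. lra. }
  eapply Rle_trans; [apply Cmod_le_abs|].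
  cbn [cexp fst snd Cminus Cplus Copp RtoC].
  replace (exp x * cos y + - (1) + - x) with ((exp x - 1 - x) + exp x * (cos y - 1)) by ring.
  replace (exp x * sin y + - 0 + - y) with ((exp x - 1) * sin y + (sin y - y)) by ring.
  assert (b1 : Rabs (exp x * (cos y - 1)) <= 3 * (e * Rabs y)).
  { rewrite Rabs_mult. apply Rmult_le_compat; try apply Rabs_pos; lra. }
  assert (b2 : Rabs ((exp x - 1) * sin y) <= (2 * Rabs x) * (2 * Rabs y)).
  { rewrite Rabs_mult. apply Rmult_le_compat; try apply Rabs_pos; lra. }
  assert (t1 := Rabs_triang (exp x - 1 - x) (exp x * (cos y - 1))).
  assert (t2 := Rabs_triang ((exp x - 1) * sin y) (sin y - y)).
  assert (b3 : Rabs x * Rabs y <= e * m) by (apply Rmult_le_compat; lra).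
  assert (b4 : e * Rabs x <= e * m) by (apply Rmult_le_compat_l; lra).
  assert (b5 : e * Rabs y <= e * m) by (apply Rmult_le_compat_l; lra).
  assert (b6 : 9 * e * m <= eps * m) by (apply Rmult_le_compat_r; lra).
  lra.
Qed.

Lemma cdiff_cexp (z : C) : cdiff cexp z.
Proof.
  apply cdiff_iff. exists (cexp z). intros eps he.
  assert (hz := exp_pos (fst z)).
  destruct (cexp_increment (eps / exp (fst z))) as [d [hd H]].
  { apply Rdiv_lt_0_compat; lra. }
  exists d. split; [exact hd|]. intros w hw. specialize (H (w - z)%C hw).
  replace (cexp w) with (cexp z * cexp (w - z))%C
    by (rewrite <- cexp_plus; f_equal; ring).
  replace (cexp z * cexp (w - z) - cexp z - (w - z) * cexp z)%C
    with (cexp z * (cexp (w - z) - 1 - (w - z)))%C by ring.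
  rewrite Cmod_mult, Cmod_cexp.
  apply (Rmult_le_compat_l (exp (fst z))) in H; [|lra].
  replace (exp (fst z) * (eps / exp (fst z) * Cmod (w - z))) with (eps * Cmod (w - z)) in H
    by (field; lra). exact H.
Qed.

Lemma cdiff_continuous_re (U : C -> C) (s t : R) :
  cdiff U (s, t) -> continuous (fun y => fst (U (s, y))) t.
Proof.
  intros H. apply cdiff_divergence_free in H.
  apply divergence_free_continuous in H. apply H.
Qed.

(** By periodicity the two horizontal sides of the rectangle contribute opposite
    amounts to the flux, so the two vertical sides balance each other. *)
Lemma vertical_mean_invariant (U : C -> C) (s1 s2 T : R) :
  s1 <= s2 -> 0 <= T ->
  (forall s t, s1 <= s <= s2 -> cdiff U (s, t)) ->
  (forall s, U (s, T) = U (s, 0)) ->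
  RInt (fun t => fst (U (s1, t))) 0 T = RInt (fun t => fst (U (s2, t))) 0 T.
Proof.
  intros hs hT hU hper.
  assert (H : flux (fun s t => fst (U (s, t))) (fun s t => snd (U (s, t))) s1 s2 0 T = 0).
  { apply flux_zero; auto. intros. apply cdiff_divergence_free, hU. assumption. }
  unfold flux in H.
  rewrite (RInt_ext (fun x => snd (U (x, T))) (fun x => snd (U (x, 0)))) in H.
  - lra.
  - intros x _. now rewrite hper.
Qed.

(** * Coefficients of polynomials as contour integrals *)

(** The coefficient of [w^k] in [w^p (1 + w)^j]; [shifted_binom j 0 k] is the
    binomial coefficient.  The shift [p] makes the recursion
    [w^p (1 + w)^(j+1) = w^p (1 + w)^j + w^(p+1) (1 + w)^j] free of boundary
    cases. *)
Fixpoint shifted_binom (j p k : nat) : R :=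
  match j with
  | O => if Nat.eq_dec p k then 1 else 0
  | S j' => shifted_binom j' p k + shifted_binom j' (S p) k
  end.

Lemma shifted_binom_nonneg j p k : 0 <= shifted_binom j p k.
Proof.
  revert p. induction j as [|j IH]; intro p; simpl.
  - destruct (Nat.eq_dec p k); lra.
  - apply Rplus_le_le_0_compat; apply IH.
Qed.

Lemma shifted_binom_sum (x : R) (j p n : nat) : (p + j <= n)%nat ->
  sum_f_R0 (fun k => shifted_binom j p k * x ^ k) n = x ^ p * (1 + x) ^ j.
Proof.
  revert p. induction j as [|j IH]; intros p hn.
  - rewrite pow_O, Rmult_1_r. simpl shifted_binom.
    revert hn. rewrite Nat.add_0_r. induction n as [|n IHn]; intro hn.
    + replace p with 0%nat by lia. simpl. ring.
    + rewrite tech5. destruct (Nat.eq_dec p (S n)) as [->|ne].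
      * rewrite (sum_eq _ (fun _ => 0)).
        { rewrite sum_cte. ring. }
        intros i hi. destruct (Nat.eq_dec (S n) i); [lia|ring].
      * rewrite IHn by lia. ring.
  - simpl shifted_binom.
    rewrite (sum_eq _ (fun k => shifted_binom j p k * x ^ k + shifted_binom j (S p) k * x ^ k))
      by (intros; ring).
    rewrite plus_sum, !IH by lia. simpl. ring.
Qed.

Lemma cexp_pow (z : C) (p : nat) : (cexp z ^ p)%C = cexp (RtoC (INR p) * z).
Proof.
  induction p as [|p IH].
  - unfold cexp. simpl. rewrite !Rmult_0_l, Rminus_0_r, Rplus_0_r.
    rewrite exp_0, cos_0, sin_0, !Rmult_1_l. reflexivity.
  - rewrite Cpow_S, IH, <- cexp_plus, S_INR, RtoC_plus. f_equal. ring.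
Qed.

Lemma trig_full_turns (p k : nat) :
  cos ((INR p - INR k) * (2 * PI)) = 1 /\ sin ((INR p - INR k) * (2 * PI)) = 0.
Proof.
  replace ((INR p - INR k) * (2 * PI)) with (- (0 + 2 * INR k * PI) + 2 * INR p * PI) by ring.
  rewrite cos_period, sin_period, cos_neg, sin_neg, cos_period, sin_period, cos_0, sin_0.
  split; ring.
Qed.

Lemma is_RInt_ext_R (f g : R -> R) (a b l : R) :
  (forall t, f t = g t) -> is_RInt f a b l -> is_RInt g a b l.
Proof. intros H. apply (is_RInt_ext (V := R_NormedModule)). intros t _. apply H. Qed.

Lemma is_RInt_full_turn (p k : nat) (a b : R) :
  is_RInt (fun t => a * cos ((INR p - INR k) * t) - b * sin ((INR p - INR k) * t))
    0 (2 * PI) (if Nat.eq_dec p k then 2 * PI * a else 0).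
Proof.
  destruct (Nat.eq_dec p k) as [->|ne].
  - apply (is_RInt_ext_R (fun _ => a)).
    + intros t. replace ((INR k - INR k) * t) with 0 by ring.
      rewrite cos_0, sin_0. ring.
    + replace (2 * PI * a) with (scal (2 * PI - 0) a : R).
      * apply (is_RInt_const (V := R_NormedModule)).
      * change ((2 * PI - 0) * a = 2 * PI * a). ring.
  - assert (ne' : INR p - INR k <> 0).
    { intro h. apply ne, INR_eq. lra. }
    set (w := INR p - INR k) in *.
    set (F := fun t => (a * sin (w * t) + b * cos (w * t)) / w).
    replace 0 with (minus (F (2 * PI)) (F 0)) at 2.
    + apply (is_RInt_derive (V := R_CompleteNormedModule)).
      * intros t _. unfold F. auto_derive; [exact I|field; exact ne'].
      * intros t _. apply (ex_derive_continuous (V := R_NormedModule)). auto_derive. exact I.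
    + destruct (trig_full_turns p k) as [h1 h2]. fold w in h1, h2.
      unfold F, minus, plus, opp; simpl. rewrite h1, h2, !Rmult_0_r, sin_0, cos_0.
      field; exact ne'.
Qed.

(** With [w = cexp (s + i t)] running over the circle of radius [e^s], this is
    Cauchy's formula for the coefficient of [w^k] in [w^p (1 + w)^j]: the last
    factor is [w^(-k)]. *)
Lemma is_RInt_coefficient (c : C) (s : R) (j p k : nat) :
  is_RInt (fun t => fst (c * (cexp (s, t) ^ p * (1 + cexp (s, t)) ^ j *
                              cexp (RtoC (- INR k) * (s, t))))%C)
    0 (2 * PI) (2 * PI * (shifted_binom j p k * fst c)).
Proof.
  revert p. induction j as [|j IH]; intro p.
  - set (r := exp ((INR p - INR k) * s)).
    apply (is_RInt_ext_R (fun t => (r * fst c) * cos ((INR p - INR k) * t) -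
       (r * snd c) * sin ((INR p - INR k) * t))).
    + intros t. change ((1 + cexp (s, t)) ^ 0)%C with (RtoC 1). rewrite Cmult_1_r, cexp_pow, <- cexp_plus.
      replace (RtoC (INR p) * (s, t) + RtoC (- INR k) * (s, t))%C
        with (((INR p - INR k) * s)%R, ((INR p - INR k) * t)%R).
      * unfold cexp. simpl. fold r. ring.
      * unfold RtoC, Cmult, Cplus. simpl. f_equal; ring.
    + simpl shifted_binom. assert (H := is_RInt_full_turn p k (r * fst c) (r * snd c)).
      destruct (Nat.eq_dec p k) as [->|ne].
      * replace (2 * PI * (1 * fst c)) with (2 * PI * (r * fst c)); [exact H|].
        unfold r. replace ((INR k - INR k) * s) with 0 by ring. rewrite exp_0. ring.
      * rewrite Rmult_0_l, Rmult_0_r. exact H.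
  - simpl shifted_binom.
    apply (is_RInt_ext_R (fun t => plus
      (fst (c * (cexp (s, t) ^ p * (1 + cexp (s, t)) ^ j * cexp (RtoC (- INR k) * (s, t))))%C)
      (fst (c * (cexp (s, t) ^ S p * (1 + cexp (s, t)) ^ j * cexp (RtoC (- INR k) * (s, t))))%C))).
    + intros t. change plus with Rplus.
      rewrite <- (re_plus _ _). unfold Re. f_equal. rewrite !Cpow_S. ring.
    + replace (2 * PI * ((shifted_binom j p k + shifted_binom j (S p) k) * fst c))
        with (plus (2 * PI * (shifted_binom j p k * fst c)) (2 * PI * (shifted_binom j (S p) k * fst c)))
        by (unfold plus; simpl; ring).
      apply (is_RInt_plus (V := R_NormedModule)); apply IH.
Qed.

(** * Cauchy estimates *)

(** Finite sums of complex numbers, with the codomain displayed as [C] rather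
    than as the carrier of an algebraic structure. *)
Definition csum (f : nat -> C) (n : nat) : C := @sum_n C_AbelianMonoid f n.

Lemma csum_S (f : nat -> C) (n : nat) : csum f (S n) = (csum f n + f (S n))%C.
Proof. apply (sum_Sn (G := C_AbelianMonoid)). Qed.

Lemma csum_O (f : nat -> C) : csum f 0 = f 0%nat.
Proof. apply (sum_O (G := C_AbelianMonoid)). Qed.

(** Partial sums of [sum_j binom(j, k) a_j z^j = z^k f^(k)(z) / k!]. *)
Definition binomial_transform (a : nat -> C) (k : nat) (z : C) (n : nat) : C :=
  csum (fun j => RtoC (shifted_binom j 0 k) * (a j * z ^ j))%C n.

Lemma is_RInt_partial_sum (a : nat -> C) (z c : C) (s : R) (k n : nat) :
  is_RInt (fun t => fst (c * (csum (fun j => a j * (z * (1 + cexp (s, t))) ^ j) n *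
                              cexp (RtoC (- INR k) * (s, t))))%C)
    0 (2 * PI) (2 * PI * fst (c * binomial_transform a k z n)%C).
Proof.
  assert (term : forall j,
    is_RInt (fun t => fst (c * (a j * (z * (1 + cexp (s, t))) ^ j *
                              cexp (RtoC (- INR k) * (s, t))))%C)
    0 (2 * PI) (2 * PI * fst (c * (RtoC (shifted_binom j 0 k) * (a j * z ^ j)))%C)).
  { intro j. assert (H := is_RInt_coefficient (c * (a j * z ^ j)) s j 0 k).
    replace (fst (c * (RtoC (shifted_binom j 0 k) * (a j * z ^ j)))%C)
      with (shifted_binom j 0 k * fst (c * (a j * z ^ j))%C).
    2:{ set (y := (a j * z ^ j)%C). unfold RtoC, Cmult; simpl; ring. }
    refine (is_RInt_ext_R _ _ _ _ _ _ H). intro t. f_equal.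
    rewrite Cpow_mult_l. change (cexp (s, t) ^ 0)%C with (RtoC 1). ring. }
  induction n as [|n IH].
  - unfold binomial_transform. rewrite csum_O.
    refine (is_RInt_ext_R _ _ _ _ _ _ (term 0%nat)). intro t. now rewrite csum_O.
  - unfold binomial_transform in *. rewrite csum_S, Cmult_plus_distr_l.
    refine (is_RInt_ext_R _ _ _ _ _ _ _).
    2:{ match type of IH with is_RInt _ _ _ ?A =>
        match type of (term (S n)) with is_RInt _ _ _ ?B =>
          replace (2 * PI * _) with (plus A B : R) end end.
        - apply (is_RInt_plus (V := R_NormedModule) _ _ _ _ _ _ IH (term (S n))).
        - change plus with Rplus. rewrite <- Rmult_plus_distr_l. f_equal. }
    intro t. change plus with Rplus. rewrite csum_S, <- (re_plus _ _). unfold Re. f_equal. ring.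
Qed.

(** The choice [c = conj q] gives [|q|^2 <= |q| B]. *)
Lemma Cmod_le_of_dual (q : C) (B : R) :
  0 <= B -> (forall c, fst (c * q)%C <= Cmod c * B) -> Cmod q <= B.
Proof.
  intros hB H. specialize (H (Cconj q)). rewrite Cmod_conj in H.
  assert (E : fst (Cconj q * q)%C = Cmod q * Cmod q).
  { unfold Cmod. rewrite sqrt_sqrt.
    - unfold Cconj, Cmult; simpl. ring.
    - assert (h := pow2_ge_0). apply Rplus_le_le_0_compat; apply h. }
  rewrite E in H. assert (h := Cmod_ge_0 q).
  destruct (Req_dec (Cmod q) 0) as [->|ne]; [exact hB|].
  apply Rmult_le_reg_l with (Cmod q); lra.
Qed.

Lemma abs_fst_sandwich (c f k : C) (B D : R) : Cmod f <= B -> Cmod k <= D ->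
  Rabs (fst (c * (f * k))%C) <= Cmod c * (B * D).
Proof.
  intros h1 h2. eapply Rle_trans; [apply abs_fst_le_Cmod|]. rewrite !Cmod_mult.
  apply Rmult_le_compat_l; [apply Cmod_ge_0|].
  apply Rmult_le_compat; auto; apply Cmod_ge_0.
Qed.

Lemma Cmod_kernel (k : nat) (s t : R) :
  Cmod (cexp (RtoC (- INR k) * (s, t))) = / exp s ^ k.
Proof.
  rewrite Cmod_cexp. simpl. replace (- INR k * s - 0 * t) with (- (INR k * s)) by ring.
  rewrite exp_Ropp. f_equal. induction k as [|k IH].
  - simpl. now rewrite Rmult_0_l, exp_0.
  - rewrite S_INR. simpl. rewrite <- IH, <- exp_plus. f_equal. ring.
Qed.

(** The mean of [g (z (1 + w)) w^(-k)] over [|w| = r] does not depend on [r].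
    On the large circle [|w| = r1] it is bounded through [M]; on the small
    circle [|w| = r], inside the disc of convergence, [g] may be replaced by a
    partial sum of the series, which yields the partial sum of
    [z^k f^(k)(z) / k!]. *)
Lemma cauchy_estimate (a : nat -> C) (g : C -> C) (z : C) (r r1 M e : R) (k n : nat) :
  0 < r -> r <= r1 -> 0 <= M -> 0 <= e ->
  (forall w, Cmod w <= r1 -> cdiff g (z * (1 + w))%C) ->
  (forall w, Cmod w <= r1 -> Cmod (g (z * (1 + w))%C) <= M) ->
  (forall w, Cmod w = r ->
     Cmod (g (z * (1 + w)) - csum (fun j => a j * (z * (1 + w)) ^ j) n)%C <= e) ->
  Cmod (binomial_transform a k z n) <= M * / r1 ^ k + e * / r ^ k.
Proof.
  intros hr hrr hM he hd hg hs.
  assert (hpi := PI_RGT_0).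
  assert (p1 : 0 < / r ^ k) by (apply Rinv_0_lt_compat, pow_lt; lra).
  assert (p2 : 0 < / r1 ^ k) by (apply Rinv_0_lt_compat, pow_lt; lra).
  apply Cmod_le_of_dual; [nra|]. intro c.
  set (U := fun x : C => (c * (g (z * (1 + cexp x)) * cexp (RtoC (- INR k) * x)))%C).
  assert (er : exp (ln r) = r) by (apply exp_ln; lra).
  assert (err : exp (ln r1) = r1) by (apply exp_ln; lra).
  assert (hmod : forall s t, Cmod (cexp (s, t)) = exp s) by (intros; apply Cmod_cexp).
  assert (hU : forall s t, s <= ln r1 -> cdiff U (s, t)).
  { intros s t hst. unfold U. apply cdiff_mult; [apply cdiff_const|]. apply cdiff_mult.
    - apply (cdiff_comp g (fun x => (z * (1 + cexp x))%C)).
      + apply hd. rewrite hmod, <- err. destruct hst as [lt| ->]; [left; now apply exp_increasing|lra].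
      + apply cdiff_mult; [apply cdiff_const|].
        apply cdiff_plus; [apply cdiff_const|apply cdiff_cexp].
    - apply (cdiff_comp cexp (fun x => (RtoC (- INR k) * x)%C)); [apply cdiff_cexp|].
      apply cdiff_mult; [apply cdiff_const|apply cdiff_id]. }
  assert (hln : ln r <= ln r1).
  { destruct hrr as [lt| ->]; [left; apply ln_increasing; lra|lra]. }
  assert (E : RInt (fun t => fst (U (ln r, t))) 0 (2 * PI) =
              RInt (fun t => fst (U (ln r1, t))) 0 (2 * PI)).
  { apply vertical_mean_invariant; auto; [lra|intros; apply hU; lra|].
    intro s. destruct (trig_full_turns 1 0) as [c1 s1]. destruct (trig_full_turns 0 k) as [c2 s2].
    simpl INR in c1, s1, c2, s2. rewrite Rminus_0_r, Rmult_1_l in c1, s1.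
    rewrite Rminus_0_l in c2, s2.
    assert (e1 : cexp (s, 2 * PI) = cexp (s, 0)).
    { unfold cexp; simpl fst; simpl snd. now rewrite c1, s1, cos_0, sin_0. }
    assert (e2 : cexp (RtoC (- INR k) * (s, 2 * PI)) = cexp (RtoC (- INR k) * (s, 0))).
    { unfold cexp; cbn [fst snd Cmult RtoC].
      rewrite !Rmult_0_l, !Rmult_0_r, !Rplus_0_r, !Rminus_0_r, c2, s2, cos_0, sin_0. reflexivity. }
    unfold U. rewrite e1, e2. reflexivity. }
  assert (hI : forall s, s <= ln r1 -> ex_RInt (fun t => fst (U (s, t))) 0 (2 * PI)).
  { intros s hst. apply (ex_RInt_continuous (V := R_CompleteNormedModule)).
    intros t _. apply cdiff_continuous_re, hU, hst. }
  assert (B1 : Rabs (RInt (fun t => fst (U (ln r1, t))) 0 (2 * PI)) <=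
               (2 * PI - 0) * (Cmod c * (M * / r1 ^ k))).
  { apply abs_RInt_le_const; [lra|apply hI; lra|]. intros t _. unfold U.
    apply abs_fst_sandwich.
    - apply hg. rewrite hmod, err. lra.
    - rewrite Cmod_kernel, err. lra. }
  assert (P := is_RInt_partial_sum a z c (ln r) k n).
  set (V := fun t => fst (c * (csum (fun j => a j * (z * (1 + cexp (ln r, t))) ^ j) n *
                              cexp (RtoC (- INR k) * (ln r, t))))%C) in P.
  assert (B2 : Rabs (RInt (fun t => V t - fst (U (ln r, t))) 0 (2 * PI)) <=
               (2 * PI - 0) * (Cmod c * (e * / r ^ k))).
  { apply abs_RInt_le_const; [lra| |].
    - apply (ex_RInt_minus (V := R_NormedModule)); [eexists; exact P|apply hI; lra].
    - intros t _. unfold V, U.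
      replace (fst _ - fst _) with (fst (c *
        ((csum (fun j => a j * (z * (1 + cexp (ln r, t))) ^ j) n - g (z * (1 + cexp (ln r, t)))) *
           cexp (RtoC (- INR k) * (ln r, t))))%C).
      + apply abs_fst_sandwich; [|rewrite Cmod_kernel, er; lra].
        rewrite <- Cmod_opp, Copp_minus_distr. apply hs. now rewrite hmod.
      + set (x1 := csum _ _). set (x2 := g _). set (x3 := cexp _). destruct c, x1, x2, x3; simpl; ring. }
  rewrite (RInt_minus (V := R_CompleteNormedModule) V (fun t => fst (U (ln r, t)))) in B2;
    [|eexists; exact P|apply hI; lra].
  rewrite (is_RInt_unique _ _ _ _ P), E in B2.
  change minus with Rminus in B2.
  apply Rabs_le_between in B1, B2.
  apply Rmult_le_reg_l with (2 * PI); lra.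
Qed.

(** * Uniform bounds near the arc *)

Lemma open_contains_disc (U : C -> Prop) (z : C) :
  @open C_UniformSpace U -> U z ->
  exists e, 0 < e /\ forall w : C, Cmod (w - z) < e -> U w.
Proof.
  intros hU hz. destruct (hU z hz) as [e He]. exists e.
  split; [apply cond_pos|]. intros w hw. apply He.
  split; [change (Rabs (fst w - fst z) < e)|change (Rabs (snd w - snd z) < e)].
  - apply Rle_lt_trans with (2 := hw). exact (abs_fst_le_Cmod (w - z)%C).
  - apply Rle_lt_trans with (2 := hw). exact (abs_snd_le_Cmod (w - z)%C).
Qed.

(** Radius and bound are encoded in the single number [d], so that one uniform
    lower bound for [d] controls both; the factor 4 absorbs the distance to a
    nearby point of the compact set to be covered. *)
Lemma holomorphic_local_bound (U : C -> Prop) (g : C -> C) (z : C) :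
  @open C_UniformSpace U -> holomorphic_on U g -> U z ->
  exists d : posreal, forall w : C, Cmod (w - z) < 4 * d -> U w /\ Cmod (g w) <= / d.
Proof.
  intros hU hg hz. destruct (open_contains_disc U z hU hz) as [e [he He]].
  assert (H := hg z hz). apply cdiff_of_ex_derive, cdiff_iff in H.
  destruct H as [l H]. destruct (H 1 Rlt_0_1) as [d [hd Hd]].
  set (B := Cmod (g z) + (1 + Cmod l) * d).
  assert (hl := Cmod_ge_0 l). assert (hgz := Cmod_ge_0 (g z)).
  assert (hB : 0 < B) by (unfold B; nra).
  assert (hm : 0 < Rmin (e / 4) (Rmin (d / 4) (/ B))).
  { repeat (apply Rmin_glb_lt; [lra|]). apply Rinv_0_lt_compat, hB. }
  exists (mkposreal _ hm). simpl pos. intros w hw.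
  set (m := Rmin (e / 4) (Rmin (d / 4) (/ B))) in *.
  assert (m1 : m <= e / 4) by apply Rmin_l.
  assert (m2 : m <= d / 4) by (eapply Rle_trans; [apply Rmin_r|apply Rmin_l]).
  assert (m3 : m <= / B) by (eapply Rle_trans; [apply Rmin_r|apply Rmin_r]).
  split; [apply He; lra|].
  apply Rle_trans with B.
  - specialize (Hd w ltac:(lra)).
    replace (g w) with ((g w - g z - (w - z) * l) + (g z + (w - z) * l))%C by ring.
    eapply Rle_trans; [apply Cmod_triangle|].
    assert (t := Cmod_triangle (g z) ((w - z) * l)). rewrite Cmod_mult in t.
    assert (s : Cmod (w - z) * Cmod l <= d * Cmod l) by (apply Rmult_le_compat_r; lra).
    unfold B. lra.
  - rewrite <- (Rinv_inv B). apply Rinv_le_contravar; assumption.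
Qed.

Lemma Cmod_expi (t : R) : Cmod (expi t) = 1.
Proof.
  replace (expi t) with (cexp (0, t)).
  - rewrite Cmod_cexp. apply exp_0.
  - unfold cexp, expi; simpl. now rewrite exp_0, !Rmult_1_l.
Qed.

Lemma lipschitz_of_derive (f df : R -> R) (s t : R) :
  (forall x, is_derive f x (df x)) -> (forall x, Rabs (df x) <= 1) ->
  Rabs (f t - f s) <= Rabs (t - s).
Proof.
  intros h1 h2. destruct (MVT_gen f s t df) as [c [_ e]].
  - intros; apply h1.
  - intros x _. apply continuity_pt_filterlim.
    apply (ex_derive_continuous (V := R_NormedModule)). exists (df x). apply h1.
  - rewrite e, Rabs_mult. assert (h := Rabs_pos (t - s)). specialize (h2 c). nra.
Qed.

Lemma expi_lipschitz (s t : R) : Cmod (expi t - expi s) <= 2 * Rabs (t - s).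
Proof.
  eapply Rle_trans; [apply Cmod_le_abs|].
  change (Rabs (cos t - cos s) + Rabs (sin t - sin s) <= 2 * Rabs (t - s)).
  assert (h1 : Rabs (cos t - cos s) <= Rabs (t - s)).
  { apply lipschitz_of_derive with (fun x => - sin x).
    - intro x. auto_derive; [exact I|ring].
    - intro x. rewrite Rabs_Ropp. apply Rabs_le, SIN_bound. }
  assert (h2 : Rabs (sin t - sin s) <= Rabs (t - s)).
  { apply lipschitz_of_derive with cos.
    - intro x. auto_derive; [exact I|ring].
    - intro x. apply Rabs_le, COS_bound. }
  lra.
Qed.

(** Compactness of the closed sector [{rho e^{it} | rho <= 1, |t| <= be}]. *)
Lemma sector_uniform_bound (U : C -> Prop) (g : C -> C) (be : R) :
  @open C_UniformSpace U -> holomorphic_on U g ->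
  (forall z, Cmod z < 1 \/ unit_arc be z -> U z) ->
  exists d, 0 < d /\ forall rho t (w : C), 0 <= rho <= 1 -> - be <= t <= be ->
    Cmod (w - RtoC rho * expi t) < d -> cdiff g w /\ Cmod (g w) <= / d.
Proof.
  intros hU hg hsub.
  set (good := fun rho t (d : posreal) => 0 <= rho <= 1 -> - be <= t <= be ->
    forall w : C, Cmod (w - RtoC rho * expi t) < 4 * d -> U w /\ Cmod (g w) <= / d).
  assert (ex : forall rho t, exists d, good rho t d).
  { intros rho t. destruct (classic (0 <= rho <= 1 /\ - be <= t <= be)) as [[h1 h2]|no].
    - destruct (holomorphic_local_bound U g (RtoC rho * expi t) hU hg) as [d Hd].
      + apply hsub. destruct (Req_dec rho 1) as [->|ne].
        * right. exists t. split; [exact h2|]. ring.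
        * left. rewrite Cmod_mult, Cmod_R, Cmod_expi, Rabs_pos_eq; lra.
      + exists d. intros _ _. exact Hd.
    - exists (mkposreal 1 Rlt_0_1). intros h1 h2. exfalso; auto. }
  set (del := fun rho t => proj1_sig (constructive_indefinite_description _ (ex rho t))).
  assert (hdel : forall rho t, good rho t (del rho t)).
  { intros rho t. exact (proj2_sig (constructive_indefinite_description _ (ex rho t))). }
  destruct (compactness_value_2d 0 1 (- be) be del) as [d Hd].
  exists d. split; [apply cond_pos|]. intros rho t w hrho ht hw.
  apply NNPP. intro bad. apply (Hd rho t hrho ht). intros [u [v [hu [hv [d1 [d2 d3]]]]]].
  apply bad. assert (G := hdel u v hu hv w). set (D := del u v) in *.
  assert (hD := cond_pos D). assert (hd := cond_pos d).
  destruct G as [Gu Gb].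
  - replace (w - RtoC u * expi v)%C with ((w - RtoC rho * expi t) +
      (RtoC (rho - u) * expi t + RtoC u * (expi t - expi v)))%C
      by (rewrite RtoC_minus; ring).
    eapply Rle_lt_trans; [apply Cmod_triangle|].
    assert (t1 := Cmod_triangle (RtoC (rho - u) * expi t) (RtoC u * (expi t - expi v))).
    rewrite !Cmod_mult, !Cmod_R, Cmod_expi, (Rabs_pos_eq u) in t1 by lra.
    assert (t2 := expi_lipschitz v t).
    assert (t3 : u * Cmod (expi t - expi v) <= 1 * Cmod (expi t - expi v))
      by (apply Rmult_le_compat_r; [apply Cmod_ge_0|lra]).
    lra.
  - split; [apply cdiff_of_ex_derive, hg, Gu|].
    eapply Rle_trans; [exact Gb|]. apply Rinv_le_contravar; lra.
Qed.

(** * Uniform convergence inside the disc *)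

Lemma csum_increment (a : nat -> C) (x : R) (z : C) (n m : nat) : Cmod z <= x ->
  Cmod (csum (fun j => a j * z ^ j)%C (n + m) - csum (fun j => a j * z ^ j)%C n) <=
  sum_f_R0 (fun j => Rabs (Cmod (a j) * x ^ j)) (n + m) -
  sum_f_R0 (fun j => Rabs (Cmod (a j) * x ^ j)) n.
Proof.
  intros hz. assert (hz0 := Cmod_ge_0 z). induction m as [|m IH].
  - rewrite Nat.add_0_r. rewrite Rminus_diag. unfold Cminus. rewrite Cplus_opp_r, Cmod_0. lra.
  - rewrite Nat.add_succ_r, csum_S, tech5. set (A := csum _ (n + m)) in *. set (B := csum _ n) in *.
    replace (A + a (S (n + m)) * z ^ S (n + m) - B)%C
      with ((A - B) + a (S (n + m)) * z ^ S (n + m))%C by ring.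
    eapply Rle_trans; [apply Cmod_triangle|]. rewrite Cmod_mult, Cmod_pow.
    assert (h : Cmod (a (S (n + m))) * Cmod z ^ S (n + m) <= Rabs (Cmod (a (S (n + m))) * x ^ S (n + m))).
    { eapply Rle_trans; [|apply Rle_abs]. apply Rmult_le_compat_l; [apply Cmod_ge_0|].
      apply pow_incr. lra. }
    lra.
Qed.

Lemma pow_n_Cpow (z : C) (n : nat) : @pow_n C_Ring z n = (z ^ n)%C.
Proof. induction n as [|n IH]; [reflexivity|]. simpl. rewrite IH. reflexivity. Qed.

(** On [|z| <= x] the tails are dominated by those of [sum_j |a_j| x^j]. *)
Lemma uniform_convergence (a : nat -> C) (g : C -> C) (x e : R) :
  Rbar_lt (Rabs x) (C_CV_radius a) -> 0 < e ->
  (forall z, Cmod z <= x -> @is_pseries C_AbsRing C_NormedModule a z (g z)) ->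
  exists n0, forall n z, (n0 <= n)%nat -> Cmod z <= x ->
    Cmod (g z - csum (fun j => a j * z ^ j)%C n) <= e.
Proof.
  intros hx he hg.
  destruct (CV_disk_inside _ _ hx) as [T hT].
  set (b := fun j => Rabs (Cmod (a j) * x ^ j)).
  assert (hT' : is_lim_seq (sum_f_R0 b) T).
  { apply is_lim_seq_ext with (2 := hT). intro n. apply sum_n_Reals. }
  assert (up : forall n, sum_f_R0 b n <= T).
  { apply is_lim_seq_incr_compare; [exact hT'|]. intro n. rewrite tech5.
    assert (h := Rabs_pos (Cmod (a (S n)) * x ^ S n)). unfold b at 3. lra. }
  apply is_lim_seq_spec in hT'. destruct (hT' (mkposreal e he)) as [n0 hn0].
  exists n0. intros n z hn hz. specialize (hn0 n hn). simpl in hn0.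
  apply Rabs_def2 in hn0.
  apply le_epsilon. intros eps heps.
  assert (hq : 0 < eps / 2) by lra.
  destruct (hg z hz _ (locally_ball (T := C_UniformSpace) (g z) (mkposreal _ hq))) as [m hm].
  specialize (hm (n + m)%nat ltac:(lia)).
  assert (E : sum_n (fun k => scal (pow_n z k) (a k)) (n + m) =
              csum (fun j => a j * z ^ j)%C (n + m)).
  { apply (sum_n_ext (G := C_AbelianMonoid)). intro k.
    change (pow_n z k * a k = a k * z ^ k)%C. rewrite pow_n_Cpow. ring. }
  assert (hb : @ball C_UniformSpace (g z) (eps / 2) (csum (fun j => a j * z ^ j)%C (n + m)))
    by (rewrite <- E; exact hm).
  destruct hb as [h1 h2].
  set (S1 := csum _ (n + m)) in *.
  change (Rabs (fst S1 - fst (g z)) < eps / 2) in h1.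
  change (Rabs (snd S1 - snd (g z)) < eps / 2) in h2.
  replace (g z - csum (fun j => a j * z ^ j) n)%C
    with (- (S1 - g z) + (S1 - csum (fun j => a j * z ^ j) n))%C by ring.
  eapply Rle_trans; [apply Cmod_triangle|]. rewrite Cmod_opp.
  assert (i1 := Cmod_le_abs (S1 - g z)).
  change (Cmod (S1 - g z) <= Rabs (fst S1 - fst (g z)) + Rabs (snd S1 - snd (g z))) in i1.
  assert (i2 := csum_increment a x z n m hz). fold b in i2. fold S1 in i2.
  specialize (up (n + m)%nat). lra.
Qed.

(** * Good sequences and the contradiction *)

Lemma expi_pow (t : R) (n : nat) : (expi t ^ n)%C = expi (INR n * t).
Proof.
  induction n as [|n IH].
  - unfold expi. simpl. now rewrite Rmult_0_l, cos_0, sin_0.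
  - rewrite Cpow_S, IH, S_INR. unfold expi, Cmult; simpl.
    replace ((INR n + 1) * t) with (t + INR n * t) by ring.
    rewrite cos_plus, sin_plus. f_equal; ring.
Qed.

(** Multiplying [a_j] by the nonnegative numbers [binom(j, k) rho^j] does not change
    its phase, so that [coefficient_bound_by_arc] applies to all derivatives. *)
Lemma Cmod_sq_binomial_transform (a : nat -> C) (r phi : nat -> R) (rho t : R) (k n : nat) :
  (forall j, a j = RtoC (r j) * expi (phi j))%C ->
  Cmod (binomial_transform a k (RtoC rho * expi t) n) ^ 2 =
  sqmod (fun j => shifted_binom j 0 k * (r j * rho ^ j)) phi n t.
Proof.
  intros ha. set (c := fun j => shifted_binom j 0 k * (r j * rho ^ j)).
  assert (E : binomial_transform a k (RtoC rho * expi t) n =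
    (sum_f_R0 (fun j => c j * cos (phi j + INR j * t)) n,
     sum_f_R0 (fun j => c j * sin (phi j + INR j * t)) n)).
  { assert (term : forall j, (RtoC (shifted_binom j 0 k) * (a j * (RtoC rho * expi t) ^ j))%C =
      (c j * cos (phi j + INR j * t), c j * sin (phi j + INR j * t))).
    { intro j. rewrite ha, Cpow_mult_l, <- RtoC_pow, expi_pow, cos_plus, sin_plus.
      unfold c, expi, RtoC, Cmult; simpl. f_equal; ring. }
    unfold binomial_transform. induction n as [|n IH].
    - rewrite csum_O. apply term.
    - rewrite csum_S, IH, term. reflexivity. }
  rewrite E. unfold sqmod, Cmod. simpl fst; simpl snd.
  apply pow2_sqrt. assert (h := pow2_ge_0). apply Rplus_le_le_0_compat; apply h.
Qed.

Lemma expi_reduce (be t : R) : 0 <= be <= PI -> cos be <= cos t ->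
  exists s, - be <= s <= be /\ expi s = expi t.
Proof.
  intros hbe hc. set (s := acos (cos t)).
  assert (cs : cos s = cos t) by apply (cos_acos _ (COS_bound t)).
  assert (bs := acos_bound (cos t)). fold s in bs.
  assert (sb : s <= be).
  { apply cos_decr_0; lra. }
  assert (ss := sin_ge_0 s ltac:(lra) ltac:(lra)).
  assert (sq : sin s * sin s = sin t * sin t).
  { assert (h1 := sin2_cos2 s). assert (h2 := sin2_cos2 t). unfold Rsqr in *.
    rewrite cs in h1. lra. }
  destruct (Rle_dec 0 (sin t)) as [p|p].
  - exists s. split; [lra|]. unfold expi. rewrite cs. f_equal.
    apply Rsqr_inj; auto.
  - exists (- s). split; [lra|]. unfold expi. rewrite cos_neg, sin_neg, cs. f_equal.
    assert (sin s = - sin t); [|lra]. apply Rsqr_inj; [lra..|]. unfold Rsqr. lra.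
Qed.

Lemma N_good_quarter_close (N : nat) (phi : nat -> R) :
  (forall n, exists Phi, forall k, (k < N)%nat -> Phi <= phi (n + k)%nat <= Phi + PI / 2) ->
  quarter_close N phi.
Proof.
  intros H.
  assert (K : forall i j, (i <= j < N + i)%nat -> 0 <= cos (phi i - phi j)).
  { intros i j h. destruct (H i) as [P HP].
    assert (h1 := HP 0%nat ltac:(lia)). assert (h2 := HP (j - i)%nat ltac:(lia)).
    rewrite Nat.add_0_r in h1. replace (i + (j - i))%nat with j in h2 by lia.
    apply cos_ge_0; lra. }
  intros i j h1 h2. destruct (Nat.le_ge_cases i j).
  - apply K; lia.
  - rewrite <- cos_neg, Ropp_minus_distr. apply K; lia.
Qed.

Lemma geometric_half_sum (n : nat) : sum_f_R0 (fun k => (/ 2) ^ k) n <= 2.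
Proof.
  rewrite tech3 by lra. assert (h := pow_lt (/ 2) (S n) ltac:(lra)). lra.
Qed.

Theorem mainTheorem2 (N : nat) (a : nat -> C) (hN : (2 <= N)%nat)
  (hgood : N_good N a) (hradius : C_CV_radius a = Finite 1%R) :
  ~ analytic_on_disc_union a (unit_arc (4 * PI / INR N)%R).
Proof.
  intros [U [g [hU [hsub [hg hser]]]]].
  destruct hgood as [r [phi [hr [ha hphi]]]]. apply N_good_quarter_close in hphi.
  destruct (coefficient_bound_by_arc N hN) as [C0 [hC0 HC]].
  destruct (sector_uniform_bound U g _ hU hg hsub) as [d [hd Hd]].
  assert (hNpos : 2 <= INR N) by (apply (le_INR 2); lia).
  assert (hpi := PI_RGT_0).
  set (be := 2 * (PI / INR N)) in *.
  assert (hbe : 0 <= be <= PI).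
  { assert (h := taper_step_range N hN). unfold be. lra. }
  assert (hbe4 : 4 * PI / INR N = 2 * be) by (unfold be; field; lra).
  rewrite hbe4 in Hd.
  set (R1 := d / 2). set (M := / d).
  assert (hM : 0 < M) by (apply Rinv_0_lt_compat, hd).
  assert (hR1 : 0 < R1) by (unfold R1; lra).
  (* rho < 1, yet (1 + R1 / 2) * rho > 1 *)
  set (rho := / (1 + R1 / 4)).
  assert (hrho : 0 < rho < 1).
  { split; [apply Rinv_0_lt_compat; lra|].
    rewrite <- Rinv_1. apply Rinv_lt_contravar; lra. }
  (* |z (1 + w)| <= (1 + rho) / 2 < 1 when |z| = rho and |w| = r0 *)
  set (r0 := Rmin R1 ((1 - rho) / 2)).
  assert (hr0 : 0 < r0) by (apply Rmin_glb_lt; lra).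
  assert (hr01 : r0 <= R1) by apply Rmin_l.
  assert (hr02 : r0 <= (1 - rho) / 2) by apply Rmin_r.
  set (K := sqrt C0 * (M + 1)).
  assert (hK : 0 <= K) by (apply Rmult_le_pos; [apply sqrt_pos|lra]).
  assert (key : forall j k, shifted_binom j 0 k * (r j * rho ^ j) <= K * / R1 ^ k).
  { intros j k.
    assert (q1 : 0 < / R1 ^ k) by (apply Rinv_0_lt_compat, pow_lt; lra).
    assert (q2 : 0 < r0 ^ k) by (apply pow_lt; lra).
    assert (he : 0 < r0 ^ k * / R1 ^ k) by nra.
    (* the error r0^k / R1^k costs only the summand 1 in M + 1 *)
    destruct (uniform_convergence a g ((1 + rho) / 2) _ ltac:(rewrite hradius; simpl;
       rewrite Rabs_pos_eq; lra) he) as [n0 Hn0].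
    { intros z hz. apply hser. lra. }
    set (c := fun j => shifted_binom j 0 k * (r j * rho ^ j)).
    assert (hc : forall i, 0 <= c i).
    { intro i. apply Rmult_le_pos; [apply shifted_binom_nonneg|].
      apply Rmult_le_pos; [apply hr|apply pow_le; lra]. }
    assert (Q : c j ^ 2 <= C0 * ((M + 1) * / R1 ^ k) ^ 2).
    { apply (HC c phi (max n0 j) j); auto; [lia|]. intros t ht.
      destruct (expi_reduce be t hbe ht) as [s [hs es]].
      rewrite <- (Cmod_sq_binomial_transform a r phi rho t k _ ha), <- es.
      apply pow_incr. split; [apply Cmod_ge_0|].
      set (z := (RtoC rho * expi s)%C).
      assert (hz : Cmod z = rho).
      { unfold z. rewrite Cmod_mult, Cmod_R, Cmod_expi, Rabs_pos_eq; lra. }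
      assert (near : forall w, Cmod w <= R1 -> Cmod (z * (1 + w) - z) < d).
      { intros w hw. replace (z * (1 + w) - z)%C with (z * w)%C by ring.
        rewrite Cmod_mult, hz. assert (h := Cmod_ge_0 w). unfold R1 in *. nra. }
      replace ((M + 1) * / R1 ^ k) with (M * / R1 ^ k + (r0 ^ k * / R1 ^ k) * / r0 ^ k)
        by (field; split; apply pow_nonzero; lra).
      apply (cauchy_estimate a g z r0 R1); try lra.
      - intros w hw. apply (Hd rho s); [lra..|]. apply near, hw.
      - intros w hw. apply (Hd rho s); [lra..|]. apply near, hw.
      - intros w hw. apply Hn0; [lia|]. rewrite Cmod_mult, hz.
        assert (h := Cmod_triangle 1 w). rewrite Cmod_1 in h. nra. }
    apply Rsqr_incr_0_var; [|apply Rmult_le_pos; lra].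
    rewrite !Rsqr_pow2. unfold K. fold (c j).
    replace ((sqrt C0 * (M + 1) * / R1 ^ k) ^ 2)
      with (sqrt C0 ^ 2 * ((M + 1) * / R1 ^ k) ^ 2) by ring.
    rewrite pow2_sqrt by exact hC0. exact Q. }
  (* summing key over k against (R1 / 2)^k recovers (1 + R1 / 2)^j *)
  assert (bound : forall j, Rabs (Cmod (a j) * ((1 + R1 / 2) * rho) ^ j) <= K * 2).
  { intro j. rewrite ha, Cmod_mult, Cmod_R, Cmod_expi, Rmult_1_r, (Rabs_pos_eq (r j)) by apply hr.
    assert (hp : 0 <= r j * ((1 + R1 / 2) * rho) ^ j).
    { apply Rmult_le_pos; [apply hr|apply pow_le; nra]. }
    rewrite Rabs_pos_eq by exact hp.
    assert (hS := shifted_binom_sum (R1 / 2) j 0 j ltac:(lia)).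
    rewrite pow_O, Rmult_1_l in hS.
    replace (r j * ((1 + R1 / 2) * rho) ^ j) with ((r j * rho ^ j) * (1 + R1 / 2) ^ j)
      by (rewrite Rpow_mult_distr; ring).
    rewrite <- hS, scal_sum.
    apply Rle_trans with (sum_f_R0 (fun k => (/ 2) ^ k * K) j).
    - apply sum_Rle. intros k _. specialize (key j k).
      apply (Rmult_le_compat_r ((R1 / 2) ^ k)) in key; [|apply pow_le; lra].
      replace (K * / R1 ^ k * (R1 / 2) ^ k) with ((/ 2) ^ k * K) in key.
      + lra.
      + unfold Rdiv. rewrite Rpow_mult_distr. field. apply pow_nonzero; lra.
    - rewrite <- scal_sum. apply Rmult_le_compat_l; [exact hK|apply geometric_half_sum]. }
  destruct (CV_radius_bounded (fun n => Cmod (a n))) as [ub _].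
  specialize (ub ((1 + R1 / 2) * rho) (ex_intro _ (K * 2) bound)).
  unfold C_CV_radius in hradius. rewrite hradius in ub. simpl in ub.
  assert (e : (1 + R1 / 4) * rho = 1) by (apply Rinv_r; lra).
  nra.
Qed.
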